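(* For any $o$-symmetric plane convex body $C\subset\mathbb{R}^2$ and any $0\le\rho\le\frac12\operatorname{perim}_C C$, the arc-distance disk $\Delta_C(\rho)=\{w\in\mathbb{R}^2:\rho_C(o,w)\le\rho\}$ is convex.
   Context: A plane convex body is a compact convex set in $\mathbb{R}^2$ with non-empty interior; $o$ denotes the origin and $o$-symmetric means $C=-C$. The $C$-distance of two points is their distance in the norm with unit ball $C$. The $C$-length of a polygonal curve is the sum of the $C$-distances of consecutive vertices, and the $C$-length of a curve is the supremum of the $C$-lengths of polygonal curves whose vertices are chosen (in order) from the curve. The perimeter $\operatorname{perim}_C D$ of a plane convex body $D$ is the $C$-length of the boundary of $D$. For points $p,q$ at $C$-distance at most two, the arc-distance $\rho_C(p,q)$ is the minimum of the $C$-lengths of the arcs with endpoints $p$ and $q$ that are contained in $\operatorname{bd}(y+C)$ for some $y\in\mathbb{R}^2$. It is not defined for points at $C$-distance greater than two; the set $\Delta_C(\rho)$ consists only of points $w$ for which $\rho_C(o,w)$ is defined. *)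

(* Defs.v *)
(* MathComp-Analysis; the plane is 'rV[R]_2 over an arbitrary R : realType. *)
From HB Require Import structures.
From mathcomp Require Export all_boot all_order all_algebra.
From mathcomp Require Export all_classical all_reals all_analysis.

Set Implicit Arguments.
Unset Strict Implicit.
Unset Printing Implicit Defensive.

Export Order.TTheory GRing.Theory Num.Theory.
Export numFieldNormedType.Exports.

Local Open Scope classical_set_scope.
Local Open Scope ring_scope.

Section plane.
Context {R : realType}.
Local Notation plane := 'rV[R]_2.
Implicit Types (C D : set plane) (p q w : plane) (g : R -> plane).

Definition bd D : set plane := closure D `\` interior D.

Definition translate w D : set plane := [set w + x | x in D].

Definition plane_convex_body C :=
  [/\ compact C, convex_set C & interior C !=set0].

Definition o_symmetric C := C = [set - x | x in C].

(* The norm with unit ball C, as the gauge of C. *)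
Definition Cnorm C w : R :=
  inf [set t | 0 <= t /\ exists2 x, C x & w = t *: x].

Definition Cdist C p q : R := Cnorm C (p - q).

Definition polygonal_length C (s : seq plane) : R :=
  \sum_(e <- zip s (behead s)) Cdist C e.1 e.2.

(* Curves are parametrised by [0, 1]; the polygon vertices are taken at
   nondecreasing parameters. *)
Definition curve_length C g : \bar R :=
  ereal_sup [set (polygonal_length C (map g s))%:E |
    s in [set s : seq R | sorted <=%R s /\ {subset s <= `[0, 1]}]].

Definition closed_parametrization D g :=
  [/\ {within `[0, 1], continuous g}, g 0 = g 1,
      {in `[0, 1[ &, injective g} & g @` `[0, 1] = bd D].

(* The boundary of a plane convex body is a simple closed curve, and its
   C-length does not depend on the parametrisation: the supremum is that of a
   singleton. *)
Definition perim C D : \bar R :=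
  ereal_sup [set curve_length C g | g in closed_parametrization D].

(* The second alternative is the degenerate arc {p}, which is possible only
   for p = q. *)
Definition arc p q g :=
  [/\ {within `[0, 1], continuous g}, g 0 = p, g 1 = q &
      {in `[0, 1] &, injective g} \/ {in `[0, 1], forall t, g t = p}].

(* For a plane convex body C and Cdist C p q <= 2, the infimum is attained,
   so that this is a minimum. *)
Definition arc_dist C p q : \bar R :=
  ereal_inf [set curve_length C g | g in
    [set g | arc p q g /\ exists y, g @` `[0, 1] `<=` bd (translate y C)]].

(* The first condition says that the arc-distance of 0 and w is defined. *)
Definition arc_disk C (rho : R) : set plane :=
  [set w | Cdist C 0 w <= 2 /\ (arc_dist C 0 w <= rho%:E)%E].

End plane.

(* Main.v *)
(* Up to translation, w lies in the disk iff it is the chord of boundary arcs of C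
   of length at most rho (or arbitrarily close to rho); the point is that
   w |-> arc_dist C 0 w is quasiconvex. Write N for the norm with unit ball C.

   If 0 < N w < 2, move the chord w = b - a of C as far as possible from the
   centre. Maximality yields unit tangent directions f at a and e at b, and we take
   the linear functional l with l f = l e = 1. By convexity, upward subchords d of
   the arc A cut off by w satisfy N d <= l d, while upward chords of the same side
   of C outside A satisfy N d >= l d. Comparing the levels of l swept by a
   boundary arc B with chord w' with those of A gives
   len B - l w' >= len A - l w; so len B >= len A as soon as l w' >= l w. If w is a
   convex combination of w1 and w2, then l w1 >= l w or l w2 >= l w. When the
   maximal chord lies on an edge of C, f = e and l is a supporting functional.

   If N w = 2, the tangents at a and b may be parallel. Then w1 and w2 lie with w
   on a supporting line of 2 C. An arc whose chord w' is on this line runs along a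
   whole side of C, with chord D, so its length is at least that of the side plus
   N (w' - D). Adding pieces of the two opposite edges to the side gives an arc
   with chord w attaining this bound, and N (w - D) is convex in w. *)
From mathcomp Require Import ring lra.
Require Import Defs.

Set Implicit Arguments.
Unset Strict Implicit.
Unset Printing Implicit Defensive.

Local Open Scope classical_set_scope.
Local Open Scope ring_scope.

(** * The norm with unit ball C *)

Section gauge.
Context {R : realType} {C : set 'rV[R]_2}.
Hypotheses (hC : plane_convex_body C) (hsym : o_symmetric C).
Implicit Types (x y v w : 'rV[R]_2) (s t : R).
Local Notation N := (Cnorm C).

Lemma body_opp x : C x -> C (- x).
Proof. by move=> Cx; rewrite hsym; exists x. Qed.

Lemma body_conv x y t : 0 <= t <= 1 -> C x -> C y ->
  C (t *: x + (1 - t) *: y).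
Proof.
move=> /andP[t0 t1] Cx Cy; have [_ cC _] := hC.
by have := cC x y (Itv01 t0 t1) (mem_set Cx) (mem_set Cy); rewrite inE.
Qed.

Lemma body_ball : exists2 e : R, 0 < e & forall x, `|x| < e -> C x.
Proof.
have [_ _ [c]] := hC; rewrite /interior/= => /nbhs_ballP[e /= e0 ce].
exists (e / 2) => [|x xe]; first by rewrite divr_gt0.
have C1 : C (c + 2 *: x).
  apply: ce; rewrite -ball_normE /ball_ /= opprD addrA subrr add0r normrN.
  by rewrite normrZ gtr0_norm// mulrC -ltr_pdivlMr.
have C2 : C (- c).
  by apply: body_opp; apply: ce; exact: ballxx.
have -> : x = 2^-1 *: (c + 2 *: x) + (1 - 2^-1) *: (- c).
  by apply/rowP => i; rewrite !mxE; field.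
by apply: body_conv => //; lra.
Qed.

Lemma body0 : C 0.
Proof. by have [e e0 eC] := body_ball; apply: eC; rewrite normr0. Qed.

Lemma body_scale x t : 0 <= t <= 1 -> C x -> C (t *: x).
Proof.
by move=> t01 Cx; have := body_conv t01 Cx body0; rewrite scaler0 addr0.
Qed.

Let S w := [set t : R | 0 <= t /\ exists2 x, C x & w = t *: x].

Let S_neq0 w : S w !=set0.
Proof.
have [e e0 eC] := body_ball; pose t := 2 * `|w| / e + 1.
have t0 : 0 < t by rewrite /t ltr_wpDl// mulr_ge0 ?invr_ge0 ?mulr_ge0// ltW.
exists t; split; first exact: ltW.
exists (t^-1 *: w); last by rewrite scalerA divff ?scale1r// gt_eqF.
apply: eC; rewrite normrZ gtr0_norm ?invr_gt0//.
rewrite mulrC ltr_pdivrMr// /t mulrDr mulr1.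
have -> : e * (2 * `|w| / e) = 2 * `|w| by field; rewrite gt_eqF.
have := normr_ge0 w; lra.
Qed.

Let S_lb w : has_lbound (S w).
Proof. by exists 0 => t []. Qed.

Let N_le_of w t : S w t -> N w <= t.
Proof. exact: (ge_inf (S_lb w)). Qed.

Let le_N w r : (forall t, S w t -> r <= t) -> r <= N w.
Proof. exact: (lb_le_inf (S_neq0 w)). Qed.

Lemma Cnorm_ge0 w : 0 <= N w.
Proof. by apply: le_N => t []. Qed.

Lemma Cnorm_le1 w : C w -> N w <= 1.
Proof. by move=> Cw; apply: N_le_of; split=> //; exists w; rewrite ?scale1r. Qed.

Let N_lt w t : N w < t -> C (t^-1 *: w).
Proof.
move=> wt; have [s [s0 [x Cx ->]] st] : exists2 s, S w s & s < t.
  exact: inf_lt (S_neq0 w) wt.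
have t0 : 0 < t by exact: le_lt_trans st.
by rewrite scalerA; apply: body_scale => //; rewrite mulrC divr_ge0 ?(ltW t0)//=
  ler_pdivrMr// mul1r ltW.
Qed.

Lemma body_of_Cnorm w : N w <= 1 -> C w.
Proof.
move=> w1; have [cC _ _] := hC; apply: contrapT => nCw.
have := compact_closed (@norm_hausdorff _ _) cC; rewrite -openC openE.
move=> /(_ _ nCw); rewrite /interior/= => /nbhs_ballP[e /= e0 we].
pose t := 1 + (`|w| / e + 1).
have t1 : 1 < t.
  by rewrite /t ltrDl ltr_wpDl// mulr_ge0 ?invr_ge0// ltW.
have t0 : 0 < t by lra.
have /we : ball w e ((t / (t - 1))^-1 *: w).
  rewrite -ball_normE /ball_ /= -[X in X - _]scale1r -scalerBl normrZ.
  have -> : 1 - (t / (t - 1))^-1 = t^-1.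
    by field; rewrite !gt_eqF// subr_gt0.
  rewrite gtr0_norm ?invr_gt0// mulrC ltr_pdivrMr// /t !mulrDr mulr1.
  by rewrite (mulrC `|w|) mulVKf ?gt_eqF//; have := normr_ge0 w; lra.
by apply; apply: N_lt; apply: le_lt_trans w1 _; rewrite ltr_pdivlMr; lra.
Qed.

Lemma CnormZ t w : 0 <= t -> N (t *: w) = t * N w.
Proof.
have le s v : 0 <= s -> N (s *: v) <= s * N v.
  rewrite le_eqVlt => /orP[/eqP<-|s0].
    rewrite scale0r mul0r; apply: N_le_of; split=> //.
    by exists 0; rewrite ?scale0r//; exact: body0.
  rewrite -ler_pdivrMl//; apply: le_N => r [r0 [x Cx ->]].
  rewrite ler_pdivrMl//; apply: N_le_of; split; first by rewrite mulr_ge0// ltW.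
  by exists x => //; rewrite scalerA.
rewrite le_eqVlt => /orP[/eqP<-|t0].
  by apply/eqP; rewrite eq_le le// mul0r scale0r Cnorm_ge0.
apply/eqP; rewrite eq_le le ?(ltW t0)//= mulrC -ler_pdivlMr// mulrC.
by rewrite -{1}(scale1r w) -(mulVf (lt0r_neq0 t0)) -scalerA le// invr_ge0 ltW.
Qed.

Lemma CnormN w : N (- w) = N w.
Proof.
have le v : N (- v) <= N v.
  apply: le_N => r [r0 [x Cx ->]]; apply: N_le_of; split=> //.
  by exists (- x); rewrite ?scalerN//; exact: body_opp.
by apply/eqP; rewrite eq_le le -{1}(opprK w) le.
Qed.

Lemma Cnorm0 : N 0 = 0.
Proof. by rewrite -(scale0r 0) CnormZ// mul0r. Qed.

Lemma ler_CnormD v w : N (v + w) <= N v + N w.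
Proof.
rewrite -lerBlDl; apply: le_N => t [t0 [y Cy ->]].
rewrite lerBlDl -lerBlDr; apply: le_N => s [s0 [x Cx ->]].
rewrite lerBlDr.
have [st|st] := eqVneq (s + t) 0.
  have -> : s = 0 by lra.
  have -> : t = 0 by lra.
  by rewrite !scale0r !addr0 Cnorm0.
have st0 : 0 < s + t by rewrite lt_neqAle eq_sym st/= addr_ge0.
apply: N_le_of; split; first exact: addr_ge0.
exists ((s / (s + t)) *: x + (1 - s / (s + t)) *: y).
  apply: body_conv => //; rewrite divr_ge0 ?(ltW st0)//= ler_pdivrMr// mul1r.
  by rewrite lerDl.
by apply/rowP => i; rewrite !mxE; field.
Qed.

Lemma ler_CnormB v w : N (v - w) <= N v + N w.
Proof. by rewrite -(CnormN w) ler_CnormD. Qed.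

Lemma Cnorm_le_norm : exists2 K : R, 0 < K & forall w, N w <= K * `|w|.
Proof.
have [e e0 eC] := body_ball; exists (2 / e) => [|w]; first by rewrite divr_gt0.
have [->|w0] := eqVneq w 0; first by rewrite Cnorm0 normr0 mulr0.
have nw : 0 < `|w| by rewrite normr_gt0.
have : N ((e / 2 / `|w|) *: w) <= 1.
  apply: Cnorm_le1; apply: eC; rewrite normrZ gtr0_norm ?divr_gt0//.
  by rewrite divfK ?gt_eqF//; lra.
rewrite CnormZ ?divr_ge0 ?(ltW e0)//.
have -> : e / 2 / `|w| * N w = N w / (2 / e * `|w|).
  by field; rewrite !gt_eqF.
by rewrite ler_pdivrMr ?mul1r// mulr_gt0// divr_gt0.
Qed.

Lemma norm_le_Cnorm : exists2 M : R, 0 < M & forall w, `|w| <= M * N w.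
Proof.
have [/compact_bounded[M [_ hM]] _ _] := hC.
pose M' := `|M| + 1.
have M0 : 0 < M' by rewrite ltr_wpDl.
exists M' => // w; rewrite -ler_pdivrMl//; apply: le_N => t [t0 [x Cx ->]].
rewrite ler_pdivrMl// normrZ ger0_norm// mulrC ler_wpM2r//.
by apply: hM => //; rewrite /M' ltr_pwDr// ler_norm.
Qed.

Lemma Cnorm_eq0 w : N w = 0 -> w = 0.
Proof.
move=> w0; have [M _ /(_ w)] := norm_le_Cnorm.
by rewrite w0 mulr0 normr_le0 => /eqP.
Qed.

Lemma Cnorm_gt0 w : w != 0 -> 0 < N w.
Proof.
move=> w0; rewrite lt_neqAle Cnorm_ge0 andbT eq_sym.
by apply: contra_neq w0; exact: Cnorm_eq0.
Qed.

Lemma bd_translateP y w : bd (translate y C) w <-> N (w - y) = 1.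
Proof.
have [K K0 hK] := Cnorm_le_norm; have [cC _ _] := hC.
have tE z : translate y C z <-> N (z - y) <= 1.
  split=> [[x Cx <-]|/body_of_Cnorm Cz]; first by rewrite addrC addKr Cnorm_le1.
  by exists (z - y) => //; rewrite addrC subrK.
have clt : closed (translate y C).
  apply: compact_closed; first exact: norm_hausdorff.
  apply: continuous_compact => //; apply: continuous_subspaceT => x.
  by apply: continuousD; [exact: cst_continuous|].
split=> [[/clt/tE w1 nI]|w1].
  apply/eqP; rewrite eq_le w1/= leNgt; apply/negP => wlt; apply: nI.
  rewrite /interior/=; apply/nbhs_ballP.
  exists ((1 - N (w - y)) / K) => /=; first by rewrite divr_gt0// subr_gt0.
  move=> z; rewrite -ball_normE /ball_/= => wz; apply/tE.
  have -> : z - y = (w - y) - (w - z).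
    by apply/rowP => i; rewrite !mxE; ring.
  apply: le_trans (ler_CnormB _ _) _; rewrite -lerBrDl.
  by apply: le_trans (hK _) _; rewrite -ler_pdivlMl// mulrC ltW.
split; first by apply: subset_closure; apply/tE; rewrite w1.
rewrite /interior/= => /nbhs_ballP[e /= e0 we].
pose d := e / (2 * (`|w - y| + 1)).
have p0 : 0 < `|w - y| + 1 by rewrite ltr_wpDl.
have d0 : 0 < d by rewrite divr_gt0// mulr_gt0.
have /we/tE : ball w e (w + d *: (w - y)).
  rewrite -ball_normE /ball_/= opprD addrA subrr add0r normrN normrZ gtr0_norm//.
  rewrite /d mulrAC ltr_pdivrMr ?mulr_gt0// ltr_pM2l//; lra.
have -> : w + d *: (w - y) - y = (1 + d) *: (w - y).
  by apply/rowP => i; rewrite !mxE; ring.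
by rewrite CnormZ ?w1; lra.
Qed.

End gauge.

Section polygons.
Context {R : realType} {C : set 'rV[R]_2}.
Hypotheses (hC : plane_convex_body C) (hsym : o_symmetric C).
Implicit Types (x y : 'rV[R]_2) (s : seq 'rV[R]_2).
Local Notation N := (Cnorm C).
Local Notation P := (polygonal_length C).

Lemma polygonal_length1 x : P [:: x] = 0.
Proof. by rewrite /polygonal_length big_nil. Qed.

Lemma polygonal_length_cons2 x y s :
  P [:: x, y & s] = N (y - x) + P (y :: s).
Proof.
by rewrite /polygonal_length big_cons/= /Cdist -(CnormN hC hsym) opprB.
Qed.

Lemma polygonal_length_cat x s1 s2 :
  P (s1 ++ x :: s2) = P (rcons s1 x) + P (x :: s2).
Proof.
elim: s1 => [|y [|z s1] IH]; first by rewrite polygonal_length1 add0r.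
  by rewrite /= !polygonal_length_cons2 polygonal_length1 addr0.
by move: IH; rewrite /= !polygonal_length_cons2 => ->; rewrite addrA.
Qed.

Lemma polygonal_length_rcons x y s :
  P (rcons (rcons s x) y) = P (rcons s x) + N (y - x).
Proof.
by rewrite -!cats1 -catA/= polygonal_length_cat cats1 polygonal_length_cons2
  polygonal_length1 addr0.
Qed.

Lemma le_polygonal_length_cons x s : P s <= P (x :: s).
Proof.
case: s => [|y s]; first by rewrite polygonal_length1 /polygonal_length big_nil.
by rewrite polygonal_length_cons2 lerDr Cnorm_ge0.
Qed.

Lemma le_polygonal_length_rcons x s : P s <= P (rcons s x).
Proof.
case/lastP: s => [|s y]; first by rewrite polygonal_length1 /polygonal_length big_nil.
by rewrite polygonal_length_rcons lerDl Cnorm_ge0.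
Qed.

Lemma polygonal_length_rev s : P (rev s) = P s.
Proof.
elim: s => [//|x [|y s] IH]; first by rewrite !polygonal_length1.
rewrite rev_cons rev_cons polygonal_length_rcons -rev_cons IH.
by rewrite polygonal_length_cons2 addrC -(CnormN hC hsym) opprB.
Qed.

Lemma polygonal_length_opp s : P (map -%R s) = P s.
Proof.
elim: s => [//|x [|y s] IH]; first by rewrite !polygonal_length1.
move: IH; rewrite /= !polygonal_length_cons2 => ->.
by rewrite -opprD (CnormN hC hsym).
Qed.

Lemma polygonal_length_shift y s : P (map (fun x => x - y) s) = P s.
Proof.
elim: s => [//|x [|z s] IH]; first by rewrite !polygonal_length1.
move: IH; rewrite /= !polygonal_length_cons2 => ->.
by rewrite opprB addrA subrK.
Qed.

End polygons.

Section frames.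
Context {R : realType}.
Implicit Types (g h x y : 'rV[R]_2) (a b t : R).

Lemma row2P x y : x 0 0 = y 0 0 -> x 0 1 = y 0 1 -> x = y.
Proof.
move=> e0 e1; apply/rowP => i; have : i \in enum 'I_2 by rewrite mem_enum.
by rewrite !(enum_ordSl, enum_ord0) !inE => /orP[] /eqP-> //;
  rewrite (_ : lift _ _ = 1)//; exact: val_inj.
Qed.

Definition det x y : R := x 0 0 * y 0 1 - x 0 1 * y 0 0.

Definition level g h x : R := det g x / det g h.
Definition absc g h x : R := det x h / det g h.

Lemma frameE g h x : det g h != 0 -> x = absc g h x *: g + level g h x *: h.
Proof.
by rewrite /absc /level /det => gh; apply: row2P; rewrite !mxE; field.
Qed.

Lemma levelD g h x y : level g h (x + y) = level g h x + level g h y.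
Proof. by rewrite /level /det !mxE; ring. Qed.
Lemma levelZ g h t x : level g h (t *: x) = t * level g h x.
Proof. by rewrite /level /det !mxE; ring. Qed.
Lemma levelN g h x : level g h (- x) = - level g h x.
Proof. by rewrite -scaleN1r levelZ mulN1r. Qed.
Lemma abscD g h x y : absc g h (x + y) = absc g h x + absc g h y.
Proof. by rewrite /absc /det !mxE; ring. Qed.
Lemma abscZ g h t x : absc g h (t *: x) = t * absc g h x.
Proof. by rewrite /absc /det !mxE; ring. Qed.
Lemma abscN g h x : absc g h (- x) = - absc g h x.
Proof. by rewrite -scaleN1r abscZ mulN1r. Qed.

Lemma level_frame g h a b : det g h != 0 -> level g h (a *: g + b *: h) = b.
Proof. by rewrite /level /det => gh; rewrite !mxE; field. Qed.
Lemma absc_frame g h a b : det g h != 0 -> absc g h (a *: g + b *: h) = a.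
Proof. by rewrite /absc /det => gh; rewrite !mxE; field. Qed.

Lemma level_continuous g h : continuous (level g h).
Proof.
have c i j : continuous (fun x : 'rV[R]_2 => x i j) by exact: coord_continuous.
move=> x; apply: (@continuousM _ _ (det g) (cst (det g h)^-1)).
  by apply: continuousB; apply: continuousM;
    (exact: cst_continuous || exact: c).
exact: cst_continuous.
Qed.

Lemma absc_continuous g h : continuous (absc g h).
Proof.
have c i j : continuous (fun x : 'rV[R]_2 => x i j) by exact: coord_continuous.
move=> x; apply: (@continuousM _ _ (det ^~ h) (cst (det g h)^-1)).
  by apply: continuousB; apply: continuousM;
    (exact: cst_continuous || exact: c).
exact: cst_continuous.
Qed.

End frames.

Section clamping.
Context {R : realType}.
Implicit Types (a b x y : R).

Definition clamp a b x := Num.max a (Num.min x b).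

Lemma clampP a b x : a <= b ->
  [\/ x <= a /\ clamp a b x = a, a <= x <= b /\ clamp a b x = x |
      b <= x /\ clamp a b x = b].
Proof.
move=> ab; rewrite /clamp; have [xb|bx] := leP x b.
  by have [|ax] := leP a x; [constructor 2|constructor 1; rewrite (ltW ax)].
by constructor 3; rewrite (ltW bx); split=> //; apply/max_idPr.
Qed.

Lemma clamp_id a b x : a <= x <= b -> clamp a b x = x.
Proof.
by case/andP => ax xb; rewrite /clamp (min_idPl xb); apply/max_idPr.
Qed.

Lemma clamp_itv a b x : a <= b -> a <= clamp a b x <= b.
Proof.
by move=> ab; case: (clampP x ab) => -[h ->]; rewrite ?lexx ?ab//.
Qed.

Lemma ler_clamp a b x y : a <= b -> x <= y -> clamp a b x <= clamp a b y.
Proof.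
move=> ab xy; case: (clampP x ab) => -[h1 ->]; case: (clampP y ab) => -[h2 ->];
  lra.
Qed.

Lemma clamp_lip a b x y : a <= b -> `|clamp a b x - clamp a b y| <= `|x - y|.
Proof.
move=> ab; have le u v : u <= v ->
    `|clamp a b u - clamp a b v| <= `|u - v|.
  move=> uv; rewrite !ler0_norm ?subr_le0 ?ler_clamp//.
  by case: (clampP u ab) => -[h1 ->]; case: (clampP v ab) => -[h2 ->]; lra.
have [/le//|/ltW/le] := leP x y.
by rewrite distrC [X in _ <= X]distrC.
Qed.

Lemma clamp_continuous a b : a <= b -> continuous (clamp a b).
Proof.
move=> ab x; apply/cvgrPdist_lt => e e0; apply/nbhs_ballP; exists e => //= y.
by rewrite /ball/=; apply: le_lt_trans; exact: clamp_lip.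
Qed.

Lemma within_clamp_continuous (V : topologicalType) a b (f : R -> V) : a <= b ->
  {within `[a, b], continuous f} -> continuous (f \o clamp a b).
Proof.
move=> ab /subspace_continuousP cf x.
have cI : `[a, b]%classic (clamp a b x) by rewrite /= in_itv/= clamp_itv.
apply: cvg_trans (cf _ cI) => A /= hA.
have h := @clamp_continuous a b ab x _ hA.
apply: (@filterS _ (nbhs x) _ _ _ _ h) => y /=.
by apply; rewrite in_itv/= clamp_itv.
Qed.

End clamping.

(** * The right boundary curve *)

Section profile.
Context {R : realType} {C : set 'rV[R]_2}.
Hypotheses (hC : plane_convex_body C) (hsym : o_symmetric C).
Context {g h : 'rV[R]_2} {H : R}.
Hypotheses (gh : det g h != 0) (HT : exists2 T, C T & level g h T = H).
Hypothesis (Hmax : forall x, C x -> level g h x <= H).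
Implicit Types (x y : 'rV[R]_2) (z t : R).
Local Notation N := (Cnorm C).
Local Notation l := (level g h).
Local Notation m := (absc g h).

Lemma top_gt0 : 0 < H.
Proof.
have [e e0 eC] := body_ball hC hsym.
have h0 : 0 < `|h| + 1 by rewrite ltr_wpDl.
have d0 : 0 < e / (`|h| + 1) by rewrite divr_gt0.
have /eC/Hmax : `|(e / (`|h| + 1)) *: h| < e.
  by rewrite normrZ gtr0_norm// mulrAC ltr_pdivrMr// ltr_pM2l// ltrDl.
by rewrite -[_ *: h]add0r -(scale0r g) level_frame//; exact: lt_le_trans.
Qed.

Lemma level_itv x : C x -> - H <= l x <= H.
Proof.
by move=> Cx; rewrite Hmax// lerNl -levelN Hmax//; exact: body_opp.
Qed.

(* The section of C at level z ends on the right at right_pt z; right_absc is the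
   junk value sup set0 when the section is empty. *)
Definition right_absc z : R := sup [set m x | x in [set x | C x /\ l x = z]].
Definition right_pt z : 'rV[R]_2 := right_absc z *: g + z *: h.
Local Notation Rp := right_absc.
Local Notation X := right_pt.

Lemma level_right z : l (X z) = z.
Proof. exact: level_frame. Qed.
Lemma absc_right z : m (X z) = Rp z.
Proof. exact: absc_frame. Qed.

Lemma section_max z : - H <= z <= H ->
  exists2 p, C p /\ l p = z & forall x, C x -> l x = z -> m x <= m p.
Proof.
move=> /andP[z1 z2]; have [T CT lT] := HT; have H0 := top_gt0.
have [|||p] := @compact_EVT_max _ _ m (C `&` [set x | l x = z]).
- exists ((z / H) *: T); split; last by rewrite /= levelZ lT divfK// gt_eqF.
  have [z0|z0] := leP 0 z.
    by apply: body_scale => //; rewrite divr_ge0 ?(ltW H0)//= ler_pdivrMr// mul1r.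
  rewrite -[_ *: T]opprK -scalerN -scaleNr; apply: body_scale => //; last exact: body_opp.
  by rewrite -mulNr divr_ge0 ?(ltW H0) ?oppr_ge0 ?(ltW z0)//= ler_pdivrMr// mul1r; lra.
- have [cC _ _] := hC; apply: compact_closedI => //.
  rewrite (_ : [set x | l x = z] = l @^-1` [set z])//.
  by apply: closed_comp; [move=> ? _; exact: level_continuous|exact: closed_eq].
- by apply: continuous_subspaceT; exact: absc_continuous.
rewrite inE => -[Cp lp] pmax; exists p => // x Cx lx.
by apply: pmax; rewrite inE.
Qed.

Lemma right_pt_max z : - H <= z <= H ->
  exists2 p, C p /\ l p = z & X z = p /\ forall x, C x -> l x = z -> m x <= m p.
Proof.
move=> /section_max[p [Cp lp] pmax]; exists p => //; split=> //.
rewrite /X [RHS](frameE _ gh) lp; congr (_ *: _ + _).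
apply/eqP; rewrite eq_le; apply/andP; split.
  by apply: ge_sup; [exists (m p), p|move=> _ [x [Cx lx] <-]; exact: pmax].
apply: ub_le_sup; last by exists p.
by exists (m p) => _ [x [Cx lx] <-]; exact: pmax.
Qed.

Lemma right_pt_in z : - H <= z <= H -> C (X z).
Proof. by move=> /right_pt_max[p [Cp _] [->]]. Qed.

Lemma absc_le_right x : C x -> m x <= Rp (l x).
Proof.
move=> Cx; have [p _ [Xp pmax]] := right_pt_max (level_itv Cx).
by rewrite -absc_right Xp pmax.
Qed.

Lemma left_le_absc x : C x -> - Rp (- l x) <= m x.
Proof.
by move=> /(body_opp hsym) /absc_le_right; rewrite abscN levelN lerNl.
Qed.

Lemma itvN z : - H <= z <= H -> - H <= - z <= H.
Proof. by move=> /andP[? ?]; apply/andP; split; lra. Qed.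

Lemma in_bodyP x : - H <= l x <= H -> - Rp (- l x) <= m x -> m x <= Rp (l x) -> C x.
Proof.
move=> lx m1 m2.
have CR := right_pt_in lx; have CL := body_opp hsym (right_pt_in (itvN lx)).
have [e|e] := eqVneq (Rp (l x)) (- Rp (- l x)).
  rewrite [x](frameE _ gh) (_ : m x = Rp (l x))//.
  by apply/eqP; rewrite eq_le m2 e m1.
have d : 0 < Rp (l x) + Rp (- l x).
  rewrite lt_neqAle; apply/andP; split; last by lra.
  by apply: contra_neq e; lra.
pose t := (m x + Rp (- l x)) / (Rp (l x) + Rp (- l x)).
have -> : x = t *: X (l x) + (1 - t) *: - X (- l x).
  have /eqP Ex := frameE x gh.
  rewrite {1}(eqP Ex) /X; apply/rowP => i; rewrite !mxE /t; field.
  by rewrite gt_eqF.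
apply: body_conv => //; rewrite /t divr_ge0 ?ler_pdivrMr ?(ltW d)//=; lra.
Qed.

Lemma right_concave z1 z2 t : - H <= z1 <= H -> - H <= z2 <= H ->
  0 <= t <= 1 -> t * Rp z1 + (1 - t) * Rp z2 <= Rp (t * z1 + (1 - t) * z2).
Proof.
move=> h1 h2 t01.
have := absc_le_right (body_conv hC t01 (right_pt_in h1) (right_pt_in h2)).
by rewrite abscD levelD !abscZ !levelZ !absc_right !level_right.
Qed.

Lemma right0_gt0 : 0 < Rp 0.
Proof.
have [e e0 eC] := body_ball hC hsym.
have g0 : 0 < `|g| + 1 by rewrite ltr_wpDl.
have d0 : 0 < e / (`|g| + 1) by rewrite divr_gt0.
have /eC/absc_le_right : `|(e / (`|g| + 1)) *: g + 0 *: h| < e.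
  rewrite scale0r addr0.
  by rewrite normrZ gtr0_norm// mulrAC ltr_pdivrMr// ltr_pM2l// ltrDl.
by rewrite absc_frame// level_frame//; exact: lt_le_trans.
Qed.

Lemma section_width z : - H < z < H -> 0 < Rp z + Rp (- z).
Proof.
have H0 := top_gt0.
have pos u : 0 <= u < H -> 0 < Rp u + Rp (- u).
  move=> /andP[u0 uH]; pose t := u / H.
  have t0 : 0 <= t by rewrite divr_ge0// ltW.
  have t1 : t < 1 by rewrite ltr_pdivrMr// mul1r.
  have tH : t * H = u by rewrite divfK// gt_eqF.
  have iH : - H <= H <= H by lra.
  have iN : - H <= - H <= H by lra.
  have i0 : - H <= 0 <= H by lra.
  have t01 : 0 <= t <= 1 by lra.
  have := right_concave iH i0 t01; have := right_concave iN i0 t01.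
  rewrite mulr0 !addr0 mulrN tH.
  have := absc_le_right (body_opp hsym (right_pt_in iN)).
  rewrite abscN levelN level_right absc_right opprK.
  have := right0_gt0.
  have : 0 < (1 - t) * Rp 0 by rewrite mulr_gt0 ?right0_gt0// subr_gt0.
  move: (Rp u) (Rp (- u)) (Rp H) (Rp (- H)) (Rp 0) => a b c d e k0 e0 cd k1 k2.
  have : 0 <= t * (c + d) by rewrite mulr_ge0//; lra.
  by rewrite mulrDr; lra.
move=> /andP[z1 z2]; have [z0|z0] := leP 0 z; first by apply: pos; lra.
by rewrite addrC -{2}(opprK z); apply: pos; lra.
Qed.

Lemma right_lsc_toward z0 E e : - H <= z0 <= H -> - H <= E <= H -> z0 != E ->
  0 < e -> exists2 d, 0 < d & forall z, 0 <= (z - z0) / (E - z0) <= 1 ->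
    `|z - z0| < d -> Rp z0 - e < Rp z.
Proof.
move=> hz0 hE z0E e0; pose B := `|Rp z0 - Rp E| + 1.
have B0 : 0 < B by rewrite ltr_wpDl.
have dE : 0 < `|E - z0| by rewrite normr_gt0 subr_eq0 eq_sym.
have nE : E - z0 != 0 by rewrite subr_eq0 eq_sym.
exists (e * `|E - z0| / B) => [|z hz zd]; first by rewrite !(divr_gt0, mulr_gt0).
set t := (z - z0) / (E - z0) in hz.
have tE : t = `|z - z0| / `|E - z0|.
  by rewrite -[t]ger0_norm ?(andP hz).1// /t normrM normfV.
have tB : t * B < e.
  by rewrite tE mulrAC ltr_pdivrMr// -ltr_pdivlMr.
have := right_concave hE hz0 hz.
have -> : t * E + (1 - t) * z0 = z by rewrite /t; field.
have tn : 0 <= t by case/andP: hz.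
have : t * (Rp z0 - Rp E) <= t * B.
  by rewrite ler_wpM2l// /B; have := ler_norm (Rp z0 - Rp E); lra.
by rewrite mulrBr; lra.
Qed.

Lemma right_usc z0 e : - H <= z0 <= H -> 0 < e ->
  exists2 d, 0 < d & forall z, - H <= z <= H -> `|z - z0| < d -> Rp z < Rp z0 + e.
Proof.
move=> hz0 e0; pose K := C `&` [set x | Rp z0 + e <= m x].
have cK : compact (l @` K).
  apply: continuous_compact.
    by apply: continuous_subspaceT; exact: level_continuous.
  have [cC _ _] := hC; apply: compact_closedI => //.
  rewrite (_ : [set x | _] = m @^-1` [set y | Rp z0 + e <= y])//.
  by apply: closed_comp; [move=> ? _; exact: absc_continuous|exact: closed_ge].
have := compact_closed (@norm_hausdorff _ R^o) cK; rewrite -openC openE.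
move=> /(_ z0); rewrite /interior /=.
have nK : ~ (l @` K) z0.
  by move=> [x [Cx /= mx] lx]; have := absc_le_right Cx; rewrite lx; lra.
move=> /(_ nK) /nbhs_ballP[d /= d0 hd]; exists d => // z hz zd.
rewrite ltNge; apply/negP => Rz.
apply: (hd z); first by rewrite /ball/= distrC.
exists (X z); last exact: level_right.
by split; [exact: right_pt_in|rewrite /= absc_right].
Qed.

Lemma right_clamp_continuous : continuous (Rp \o clamp (- H) H).
Proof.
have H0 := top_gt0; have HH : - H <= H by lra.
move=> w; apply/cvgrPdist_lt => e e0 /=.
set z0 := clamp _ _ w; have hz0 : - H <= z0 <= H by exact: clamp_itv.
have lsc E : - H <= E <= H -> exists2 d, 0 < d & forall z,
    (E - z0 != 0 -> 0 <= (z - z0) / (E - z0) <= 1) -> (E = z0 -> z = z0) ->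
    `|z - z0| < d -> Rp z0 - e < Rp z.
  move=> hE; have [E0|E0] := eqVneq z0 E.
    by exists 1 => // z _ ->//; lra.
  have [d d0 hd] := right_lsc_toward hz0 hE E0 e0; exists d => // z zE _.
  by apply: hd; apply: zE; rewrite subr_eq0 eq_sym.
have [|d1 d10 h1] := lsc H; first by lra.
have [|d2 d20 h2] := lsc (- H); first by lra.
have [d3 d30 h3] := right_usc hz0 e0.
apply/nbhs_ballP; exists (Num.min d1 (Num.min d2 d3)) => /=.
  by rewrite !lt_min d10 d20.
move=> y; rewrite /ball/= => wy; set z := clamp _ _ y.
have hz : - H <= z <= H by exact: clamp_itv.
have : `|z - z0| < Num.min d1 (Num.min d2 d3).
  by apply: le_lt_trans wy; rewrite distrC; exact: clamp_lip.
rewrite !lt_min => /and3P[zd1 zd2 zd3].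
have up := h3 z hz zd3.
have dn : Rp z0 - e < Rp z.
  have [zz|zz] := leP z0 z.
    apply: h1 => // [nE|E0]; last by lra.
    have p : 0 < H - z0 by rewrite lt_neqAle eq_sym nE; lra.
    by rewrite divr_ge0 ?ler_pdivrMr//=; lra.
  apply: h2 => // [nE|E0]; last by lra.
  have p : 0 < z0 + H by rewrite lt_neqAle eq_sym -oppr_eq0 opprD addrC nE; lra.
  rewrite (_ : (z - z0) / (- H - z0) = (z0 - z) / (z0 + H)).
    by rewrite divr_ge0 ?ler_pdivrMr//=; lra.
  by field; rewrite nE gt_eqF.
by rewrite ltr_norml; apply/andP; split; lra.
Qed.

Lemma right_pt_clamp_continuous : continuous (X \o clamp (- H) H).
Proof.
have HH : - H <= H by have := top_gt0; lra.
move=> w; apply: cvgD; apply: cvgZ; try exact: cvg_cst.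
  exact: right_clamp_continuous.
exact: clamp_continuous.
Qed.

End profile.

(** * Boundary paths crossing a strip *)

Section real_paths.
Context {R : realType}.
Implicit Types (f a b : R -> R) (s t u v x y : R).

Lemma ivt_between f x y z : continuous f -> x <= y ->
  (f x <= z <= f y) || (f y <= z <= f x) -> exists2 t, x <= t <= y & f t = z.
Proof.
move=> cf xy h; have [||t] := @IVT _ f x y z xy.
- exact: continuous_subspaceT.
- rewrite ge_min le_max; case/orP: h => /andP[-> ->]//; by rewrite !orbT.
by rewrite in_itv/= => ht ft; exists t.
Qed.

Lemma last_upcrossing f : continuous f -> f 0 < f 1 ->
  exists t0 t1, [/\ 0 <= t0, t0 < t1 & t1 <= 1] /\ [/\ f t0 = f 0, f t1 = f 1 &
    forall t, t0 < t < t1 -> f 0 < f t < f 1].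
Proof.
move=> cf f01.
have cpt u v z : compact (`[u, v] `&` [set t : R | f t = z])%classic.
  apply: compact_closedI; first exact: segment_compact.
  rewrite (_ : [set t | _] = f @^-1` [set z])//.
  by apply: closed_comp; [move=> ? _; exact: cf|exact: closed_eq].
have cid (A : set R) : {within A, continuous (@idfun R)}.
  by apply: continuous_subspaceT => x; exact: cvg_id.
have [|t1] := compact_EVT_min _ (cpt 0 1 (f 1)) (cid _).
  by exists 1; split=> //=; rewrite in_itv/= ler01 lexx.
rewrite inE => -[/=]; rewrite in_itv/= => /andP[t10 t11] ft1 min1.
have lt1 t : 0 <= t < t1 -> f t < f 1.
  move=> /andP[t0 tt1]; rewrite ltNge; apply/negP => ft.
  have [|s /andP[s0 st] fs] := @ivt_between f 0 t (f 1) cf t0.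
    by rewrite ft (ltW f01).
  have : t1 <= s by apply: min1; rewrite inE; split=> //=; rewrite in_itv/=; lra.
  lra.
have [|t0] := compact_EVT_max _ (cpt 0 t1 (f 0)) (cid _).
  by exists 0; split=> //=; rewrite in_itv/= t10 lexx.
rewrite inE => -[/=]; rewrite in_itv/= => /andP[t00 t01] ft0 max0.
have t0t1 : t0 < t1.
  rewrite lt_neqAle t01 andbT; apply/eqP => e.
  by move: f01; rewrite -ft0 e ft1 ltxx.
exists t0, t1; split; split => // t /andP[t0t tt1]; rewrite lt1; last by lra.
rewrite andbT ltNge; apply/negP => ft.
have [|s /andP[ts st1] fs] := @ivt_between f t t1 (f 0) cf (ltW tt1).
  by rewrite ft ft1 (ltW f01).
have : s <= t0 by apply: max0; rewrite inE; split=> //=; rewrite in_itv/=; lra.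
lra.
Qed.

Lemma zero_branch a b t0 t1 : continuous a -> continuous b -> t0 < t1 ->
  (forall t, t0 < t < t1 -> (a t = 0 \/ b t = 0) /\ 0 < a t + b t) ->
  (forall t, t0 <= t <= t1 -> a t = 0) \/ (forall t, t0 <= t <= t1 -> b t = 0).
Proof.
move=> ca cb t01 hab.
have closure f c : continuous f -> t0 < c < t1 ->
    (forall t, t0 < t < t1 -> f t = 0) -> forall t, t0 <= t <= t1 -> f t = 0.
  move=> cf /andP[c0 c1] f0 t /andP[h0 h1].
  have fc : f c = 0 by apply: f0; rewrite c0.
  apply/eqP/negPn/negP => ft.
  have [s [[st sI]|sI] fs] : exists2 s, s != t /\ t0 < s < t1 \/ s = t & f s = f t / 2.
    have [tc|ct] := leP t c.
      have [|s hs fs] := @ivt_between f t c (f t / 2) cf tc; first by rewrite fc; lra.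
      exists s => //; have [->|st] := eqVneq s t; [by right|left; split=> //].
      have : t < s by rewrite lt_neqAle eq_sym st; case/andP: hs.
      by case/andP: hs => *; apply/andP; split; lra.
    have [|s hs fs] := @ivt_between f c t (f t / 2) cf (ltW ct); first by rewrite fc; lra.
    exists s => //; have [->|st] := eqVneq s t; [by right|left; split=> //].
    have : s < t by rewrite lt_neqAle st; case/andP: hs.
    by case/andP: hs => *; apply/andP; split; lra.
  - move/eqP: ft; rewrite f0 in fs => //; lra.
  - move/eqP: ft; rewrite sI in fs; lra.
have diff c t : t0 < c < t1 -> t0 < t < t1 -> a c = 0 -> b t = 0 -> False.
  move=> hc ht ac bt.
  have [_] := hab _ hc; have [_] := hab _ ht; rewrite ac bt addr0 add0r => at0 bc0.
  have cd : continuous (fun t => a t - b t).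
    by move=> x; apply: continuousB; [exact: ca|exact: cb].
  have [s hs] : exists2 s, t0 < s < t1 & a s - b s = 0.
    have [tc|ct] := leP t c.
      have [|s hs fs] := @ivt_between _ t c 0 cd tc; first by rewrite ac bt; lra.
      by exists s => //; lra.
    have [|s hs fs] := @ivt_between _ c t 0 cd (ltW ct); first by rewrite ac bt; lra.
    by exists s => //; lra.
  by have [[] + ] := hab _ hs; lra.
have hc : t0 < (t0 + t1) / 2 < t1 by apply/andP; split; lra.
have [[ac|bc] _] := hab _ hc; [left|right]; apply: (closure _ _ _ hc) => // t ht.
  by have [[//|bt] _] := hab _ ht; case: (diff _ _ hc ht).
by have [[at0|//] _] := hab _ ht; case: (diff _ _ ht hc).
Qed.

Lemma lift_levels f (s : seq R) x y : continuous f -> x <= y ->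
  path <=%R (f x) s -> all (<= f y) s ->
  exists ts, [/\ path <=%R x ts, all (<= y) ts & map f ts = s].
Proof.
move=> cf; elim: s x => [|z s IH] x xy /=; first by exists [::].
move=> /andP[xz zs] /andP[zy sy].
have [|t /andP[xt ty] ft] := @ivt_between f x y z cf xy; first by rewrite xz zy.
have [|ts [p1 p2 p3]] := IH t ty _ sy; first by rewrite ft.
by exists (t :: ts); rewrite /= xt p1 ty p2 ft p3.
Qed.

End real_paths.

Section crossing.
Context {R : realType} {C : set 'rV[R]_2}.
Hypotheses (hC : plane_convex_body C) (hsym : o_symmetric C).
Context {g h : 'rV[R]_2} {H : R}.
Hypotheses (gh : det g h != 0) (HT : exists2 T, C T & level g h T = H).
Hypothesis (Hmax : forall x, C x -> level g h x <= H).
Implicit Types (x y p q : 'rV[R]_2) (z t : R).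
Local Notation N := (Cnorm C).
Local Notation P := (polygonal_length C).
Local Notation l := (level g h).
Local Notation m := (absc g h).
Local Notation Rp := (@right_absc R C g h).
Local Notation X := (@right_pt R C g h).

Let H0 : 0 < H := top_gt0 hC hsym gh Hmax.
Let HH : - H <= H. Proof. by have := H0; lra. Qed.
Let cRp := right_clamp_continuous hC hsym gh HT Hmax.

Lemma boundary_section_end x : N x = 1 -> - H < l x < H ->
  m x = Rp (l x) \/ m x = - Rp (- l x).
Proof.
move=> Nx lx; have Cx : C x by apply: (body_of_Cnorm hC hsym); rewrite Nx.
have h1 := absc_le_right hC hsym gh HT Hmax Cx.
have h2 := left_le_absc hC hsym gh HT Hmax Cx.
apply: contrapT => /not_orP[/eqP n1 /eqP n2].
have {}h1 : m x < Rp (l x) by rewrite lt_neqAle n1.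
have {}h2 : - Rp (- l x) < m x by rewrite lt_neqAle eq_sym n2.
have cM c : continuous (fun s : R => s * c).
  by move=> s; apply: cvgM; [exact: cvg_id|exact: cvg_cst].
have cR c : continuous (fun s : R => Rp (clamp (- H) H (s * c))).
  by move=> s; apply: (@continuous_comp _ _ _ (fun s : R => s * c)
    (Rp \o clamp (- H) H)); [exact: cM|exact: cRp].
pose F : R -> R := (fun s => Rp (clamp (- H) H (s * l x)) - s * m x) \min
  ((fun s => s * m x + Rp (clamp (- H) H (s * - l x))) \min
    ((fun s => H - s * l x) \min (fun s => H + s * l x))).
have cF : continuous F.
  move=> s; apply: continuous_min; first by apply: continuousB; [exact: cR|exact: cM].
  apply: continuous_min; first by apply: continuousD; [exact: cM|exact: cR].
  by apply: continuous_min; [apply: continuousB|apply: continuousD];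
    (exact: cst_continuous || exact: cM).
have F1 : 0 < F 1.
  rewrite /F /= !mul1r !clamp_id; try by move: lx; lra.
  by rewrite !lt_min; apply/and4P; split; lra.
have /cvgrPdist_lt/(_ _ F1)/nbhs_ballP[e /= e0 he] := cF 1.
have : `|F 1 - F (1 + e / 2)| < F 1.
  by apply: he; rewrite /ball/= opprD addrA subrr add0r normrN gtr0_norm; lra.
rewrite ltr_norml => /andP[_]; rewrite -subr_gt0 opprB addrC subrK.
set s := 1 + e / 2; have s1 : 1 < s by rewrite /s; lra.
rewrite /F /= !lt_min => /and4P[k1 k2 k3 k4].
have hs : - H <= s * l x <= H by lra.
rewrite clamp_id// in k1; rewrite mulrN clamp_id in k2; last by lra.
have /(Cnorm_le1) : C (s *: x).
  by apply: (in_bodyP hC hsym gh HT Hmax); rewrite levelZ ?abscZ//; lra.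
by rewrite (CnormZ hC hsym) ?Nx; lra.
Qed.

Lemma crossing (G : R -> 'rV[R]_2) : continuous G ->
  (forall t, 0 <= t <= 1 -> N (G t) = 1) -> l (G 0) < l (G 1) ->
  let lifts Y := forall s, sorted <=%R s -> {subset s <= `[l (G 0), l (G 1)]} ->
    exists ts, [/\ sorted <=%R ts, {subset ts <= `[0, 1]} &
      map G ts = map Y s] in
  lifts X \/ lifts (fun z => - X (- z)).
Proof.
move=> cG NG lG lifts.
have cl : continuous (l \o G).
  by move=> t; apply: continuous_comp; [exact: cG|exact: level_continuous].
have cm : continuous (m \o G).
  by move=> t; apply: continuous_comp; [exact: cG|exact: absc_continuous].
have [t0 [t1 [[t00 t01 t11] [ft0 ft1 hin]]]] := last_upcrossing cl lG.
rewrite /= in ft0 ft1 hin.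
have CG t : 0 <= t <= 1 -> C (G t).
  by move=> /NG e; apply: (body_of_Cnorm hC hsym); rewrite e.
have lI t : 0 <= t <= 1 -> - H <= l (G t) <= H.
  by move=> /CG; exact: (level_itv hsym Hmax).
have hmid t : t0 < t < t1 -> 0 <= t <= 1 by lra.
have lI' t : t0 < t < t1 -> - H < l (G t) < H.
  move=> ht; have := hin _ ht.
  have : - H <= l (G 0) <= H by apply: lI; lra.
  have : - H <= l (G 1) <= H by apply: lI; lra.
  by lra.
pose a t := (Rp \o clamp (- H) H) (l (G t)) - m (G t).
pose b t := m (G t) + (Rp \o clamp (- H) H) (- l (G t)).
pose rl t := (Rp \o clamp (- H) H) (l (G t)).
pose rr t := (Rp \o clamp (- H) H) (- l (G t)).
have ca : continuous a.
  move=> t; apply: (@continuousB _ _ _ rl (m \o G)); last exact: cm.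
  by apply: (@continuous_comp _ _ _ (l \o G)); [exact: cl|exact: cRp].
have cb : continuous b.
  move=> t; apply: (@continuousD _ _ _ (m \o G) rr); first exact: cm.
  apply: (@continuous_comp _ _ _ (fun t => - l (G t))); last exact: cRp.
  by apply: continuousN; exact: cl.
have up s Y : (forall t, t0 <= t <= t1 -> G t = Y (l (G t))) ->
    sorted <=%R s -> {subset s <= `[l (G 0), l (G 1)]} ->
    exists ts, [/\ sorted <=%R ts, {subset ts <= `[0, 1]} & map G ts = map Y s].
  move=> GY ss sI.
  have sP : path <=%R ((l \o G) t0) s.
    rewrite /= ft0; case: s ss sI => //= z s -> sI; rewrite andbT.
    by have := sI z (mem_head _ _); rewrite in_itv/= => /andP[].
  have sA : all (<= (l \o G) t1) s.
    by apply/allP => z /sI; rewrite in_itv/= ft1 => /andP[].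
  have [ts [p1 p2 p3]] := lift_levels cl (ltW t01) sP sA.
  have tsI t : t \in ts -> t0 <= t <= t1.
    move=> tts; apply/andP; split; last exact: (allP p2 _ tts).
    exact: (allP (order_path_min le_trans p1) _ tts).
  exists ts; split; first exact: path_sorted p1.
    by move=> t /tsI ht; rewrite in_itv/=; lra.
  by rewrite -p3 -map_comp; apply/eq_in_map => t /tsI ht /=; rewrite -GY.
have [t ht|k|k] := @zero_branch _ a b t0 t1 ca cb t01.
- have lt := lI' t ht; rewrite /a /b /= !clamp_id; try lra.
  split; last by have := section_width hC hsym gh HT Hmax lt; lra.
  have [->|->] := boundary_section_end (NG _ (hmid _ ht)) lt; first by left; lra.
  by right; lra.
- left => s; apply: up => t ht; have := k t ht.
  have := lI t; rewrite /a /= => lt; rewrite clamp_id; last by apply: lt; lra.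
  rewrite /right_pt => e; rewrite [LHS](frameE (G t) gh).
  by congr (_ *: _ + _); lra.
- right => s; apply: (up _ (fun z => - X (- z))) => t ht; have := k t ht.
  have := lI t; rewrite /b /= => lt; rewrite clamp_id.
    rewrite /right_pt => e; rewrite [LHS](frameE (G t) gh).
    by rewrite opprD scaleNr opprK -scaleNr; congr (_ *: _ + _); lra.
  by have := lt; lra.
Qed.

Lemma curve_lower (f : R -> 'rV[R]_2) : {within `[0, 1], continuous f} ->
  (forall t, 0 <= t <= 1 -> N (f t) = 1) -> l (f 0) < l (f 1) ->
  exists p q, [/\ C p, C q, q - p = f 1 - f 0 & forall s,
    sorted <=%R s -> {subset s <= `[l p, l q]} ->
    ((P (p :: rcons (map X s) q))%:E <= curve_length C f)%E].
Proof.
move=> cf Nf lf; have c01 : (0 : R) <= 1 := ler01.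
have cG := within_clamp_continuous c01 cf.
set G := _ \o _ in cG.
have GE t : 0 <= t <= 1 -> G t = f t by move=> ht; rewrite /G /= clamp_id.
have G0 : G 0 = f 0 by rewrite GE ?lexx.
have G1 : G 1 = f 1 by rewrite GE ?lexx ?ler01.
have NG t : 0 <= t <= 1 -> N (G t) = 1 by move=> ht; rewrite GE ?Nf.
have Cf t : 0 <= t <= 1 -> C (f t).
  by move=> /Nf e; apply: (body_of_Cnorm hC hsym); rewrite e.
have bound ts : sorted <=%R ts -> {subset ts <= `[0, 1]} ->
    ((P (f 0 :: rcons (map f ts) (f 1)))%:E <= curve_length C f)%E.
  move=> ss sI; apply: ereal_sup_ubound; exists (0 :: rcons ts 1).
    split=> [|t]; last first.
      rewrite inE mem_rcons inE => /orP[/eqP->|/orP[/eqP->|/sI//]];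
      by rewrite in_itv/= ?lexx ?ler01.
    rewrite /= -cats1 cat_path /= andbT; apply/andP; split.
      case: ts ss sI => //= t ts -> sI.
      by have := sI _ (mem_head _ _); rewrite in_itv/= andbT => /andP[].
    have : last 0 ts \in 0 :: ts by exact: mem_last.
    rewrite inE => /orP[/eqP->|/sI]; first exact: ler01.
    by rewrite in_itv/= => /andP[].
  by rewrite /= map_rcons.
have mapG ts : {subset ts <= `[0, 1]} -> map G ts = map f ts.
  by move=> sI; apply/eq_in_map => t /sI; rewrite in_itv/=; exact: GE.
have lG : l (G 0) < l (G 1) by rewrite G0 G1.
have [k|k] := crossing cG NG lG.
  exists (f 0), (f 1); split; [by apply: Cf; rewrite lexx ler01|by apply: Cf; rewrite ler01 lexx|by []|].
  move=> s ss sI; rewrite -{}G0 -{}G1 in sI *.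
  have [ts [p1 p2 p3]] := k s ss sI.
  by rewrite -p3 mapG// GE ?lexx ?ler01// GE ?lexx ?ler01//; exact: bound.
exists (- f 1), (- f 0); split.
- by apply: (body_opp hsym); apply: Cf; rewrite ler01 lexx.
- by apply: (body_opp hsym); apply: Cf; rewrite ler01 lexx.
- by rewrite opprK addrC.
move=> s ss sI; have [||ts [p1 p2 p3]] := k (rev (map -%R s)).
- rewrite rev_sorted sorted_map; apply: sub_sorted ss => x y /=.
  by rewrite lerN2.
- move=> z; rewrite mem_rev => /mapP[y /sI]; rewrite !levelN G0 G1 !in_itv/=.
  by move=> hy ->; lra.
rewrite -(polygonal_length_opp hC hsym) -(polygonal_length_rev hC hsym).
rewrite /= map_rcons rev_cons rev_rcons !opprK -map_comp rcons_cons.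
move: p3; rewrite mapG// map_rev -map_comp => p3.
have E : map f ts = rev (map (-%R \o X) s).
  by rewrite p3; congr rev; apply: eq_map => z /=; rewrite opprK.
by rewrite -E; exact: bound.
Qed.

End crossing.

(** * Comparison of lengths *)

Section comparison.
Context {R : realType} {C : set 'rV[R]_2}.
Hypotheses (hC : plane_convex_body C) (hsym : o_symmetric C).
Implicit Types (x y p q w : 'rV[R]_2) (z t : R) (s : seq R).
Local Notation N := (Cnorm C).
Local Notation P := (polygonal_length C).

Lemma arc_dist_le_param (Y : R -> 'rV[R]_2) z1 z2 (M : \bar R) : z1 < z2 ->
  continuous Y -> (forall z, z1 <= z <= z2 -> N (Y z) = 1) ->
  {in `[z1, z2] &, injective Y} ->
  (forall s, sorted <=%R s -> {subset s <= `[z1, z2]} ->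
    ((P (map Y s))%:E <= M)%E) ->
  (arc_dist C 0 (Y z2 - Y z1) <= M)%E.
Proof.
move=> z12 cY NY iY hM; have d0 : 0 < z2 - z1 by rewrite subr_gt0.
pose a t := z1 + t * (z2 - z1).
have aI t : t \in `[0, 1] -> z1 <= a t <= z2.
  rewrite in_itv/= => /andP[t0 t1]; rewrite /a lerDl mulr_ge0 ?(ltW d0)//=.
  by rewrite -lerBrDl ler_piMl// ltW.
have ca : continuous a.
  move=> t; apply: (@continuousD _ _ _ (cst z1) (fun t => t * (z2 - z1))).
    exact: cst_continuous.
  by apply: continuousM; [exact: cvg_id|exact: cst_continuous].
pose f t := Y (a t) - Y z1.
apply: (@le_trans _ _ (curve_length C f)).
  apply: ereal_inf_lbound; exists f => //; split; last first.
    exists (- Y z1) => _ [t tI <-]; apply/(bd_translateP hC hsym).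
    by rewrite opprK subrK NY// aI.
  split.
  - apply: continuous_subspaceT => t.
    apply: (@continuousB _ _ _ (Y \o a) (cst (Y z1))).
      by apply: continuous_comp; [exact: ca|exact: cY].
    exact: cst_continuous.
  - by rewrite /f /a mul0r addr0 subrr.
  - by rewrite /f /a mul1r (addrC z1) subrK.
  - left => t t' tI t'I e.
    have : Y (a t) = Y (a t') by apply: (addIr (- Y z1)); exact: e.
    move=> /iY; rewrite !in_itv/= => /(_ (aI _ tI) (aI _ t'I)) /addrI.
    by apply: mulIf; rewrite gt_eqF.
apply/ereal_supP => _ [s [ss sI] <-].
have := polygonal_length_shift hC hsym (Y z1) (map (Y \o a) s).
rewrite -map_comp => ->; rewrite map_comp; apply: hM.
  rewrite sorted_map; apply: sub_sorted ss => t t' tt' /=.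
  by rewrite lerD2l ler_pM2r.
by move=> _ /mapP[t /sI /aI ht ->]; rewrite in_itv.
Qed.

Lemma curve_length_shift y (f : R -> 'rV[R]_2) :
  curve_length C (fun t => f t - y) = curve_length C f.
Proof.
rewrite /curve_length; congr ereal_sup; apply: eq_imagel => s _; congr EFin.
have := polygonal_length_shift hC hsym y (map f s).
by rewrite -map_comp => <-.
Qed.

Context {g h : 'rV[R]_2} {H : R}.
Hypotheses (gh : det g h != 0) (HT : exists2 T, C T & level g h T = H).
Hypothesis (Hmax : forall x, C x -> level g h x <= H).
Local Notation l := (level g h).
Local Notation m := (absc g h).
Local Notation Rp := (@right_absc R C g h).
Local Notation X := (@right_pt R C g h).

Let H0 : 0 < H := top_gt0 hC hsym gh Hmax.
Let HH : - H <= H. Proof. by have := H0; lra. Qed.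

Lemma level_le_Cnorm x : l x <= H * N x.
Proof.
have [->|x0] := eqVneq x 0.
  by rewrite (Cnorm0 hC hsym) mulr0 -(scale0r g) levelZ mul0r.
have Nx := Cnorm_gt0 hC hsym x0.
rewrite -ler_pdivrMr// mulrC -levelZ; apply: Hmax.
apply: (body_of_Cnorm hC hsym).
by rewrite (CnormZ hC hsym) ?mulVf ?gt_eqF// invr_ge0 ltW.
Qed.

Lemma right_end_Cnorm x : C x -> m x = Rp (l x) -> N x = 1.
Proof.
move=> Cx mx; apply/eqP; rewrite eq_le (Cnorm_le1 Cx)/= leNgt; apply/negP => Nx.
have N0 := Cnorm_ge0 hC hsym g.
pose d := (1 - N x) / (N g + 1).
have d0 : 0 < d by rewrite divr_gt0 ?subr_gt0// ltr_wpDl.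
have /(absc_le_right hC hsym gh HT Hmax) : C (x + d *: g).
  apply: (body_of_Cnorm hC hsym); apply: le_trans (ler_CnormD hC hsym _ _) _.
  rewrite (CnormZ hC hsym) ?(ltW d0)//.
  have : d * (N g + 1) = 1 - N x by rewrite divfK// gt_eqF// ltr_wpDl.
  by rewrite mulrDr; lra.
have := level_frame 1 0 gh; have := absc_frame 1 0 gh.
rewrite scale0r addr0 scale1r => mg lg.
by rewrite abscD levelD !abscZ !levelZ mg lg mulr0 addr0 mx; lra.
Qed.

Lemma right_pt_Cnorm z : - H <= z <= H -> N (X z) = 1.
Proof.
move=> hz; apply: right_end_Cnorm; first exact: (right_pt_in hC hsym gh HT Hmax).
by rewrite (absc_right gh) (level_right gh).
Qed.

Lemma right_pt_inj : injective X.
Proof. by move=> z z' /(congr1 l); rewrite !(level_right gh). Qed.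

(* Every boundary arc rising by at least y2 - y1 is at least as long as the piece
   between the levels y1 and y2: clamping a polygon inscribed in the piece to the
   levels swept by the arc trades short chords for long ones. *)
Section shortest.
Context {y1 y2 : R}.
Hypotheses (hy1 : - H <= y1) (hy : y1 < y2) (hy2 : y2 <= H).
Hypothesis short_in : forall z z', y1 <= z -> z <= z' -> z' <= y2 ->
  N (X z' - X z) <= z' - z.
Hypothesis long_out : forall z z', - H <= z -> z <= z' -> z' <= H ->
  z' <= y1 \/ y2 <= z -> z' - z <= N (X z' - X z).

Let short_clamp u v z z' : u <= v -> y1 <= z -> z <= z' -> z' <= y2 ->
  N (X z' - X z) - (z' - z) <=
  N (X (clamp u v z') - X (clamp u v z)) - (clamp u v z' - clamp u v z).
Proof.
move=> uv h1 h2 h3; have le := ler_clamp uv h2.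
have [e|ne] := eqVneq (clamp u v z) (clamp u v z').
  by rewrite e !subrr (Cnorm0 hC hsym) subrr; have := short_in h1 h2 h3; lra.
have lt : clamp u v z < clamp u v z' by rewrite lt_neqAle ne.
have [zc zc'] : z <= clamp u v z /\ clamp u v z' <= z'.
  move: lt; case: (clampP z uv) => -[a ->]; case: (clampP z' uv) => -[b ->]; lra.
set c := clamp u v z in lt zc *; set c' := clamp u v z' in lt zc' *.
have k1 : N (X c - X z) <= c - z by apply: short_in; lra.
have k2 : N (X z' - X c') <= z' - c' by apply: short_in; lra.
have -> : X z' - X z = (X z' - X c') + ((X c' - X c) + (X c - X z)).
  by apply/rowP => i; rewrite !mxE; ring.
have := ler_CnormD hC hsym (X z' - X c') ((X c' - X c) + (X c - X z)).
by have := ler_CnormD hC hsym (X c' - X c) (X c - X z); lra.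
Qed.

Let short_clamp_seq (u v x : R) s : u <= v -> path <=%R x s ->
  {subset x :: s <= `[y1, y2]} ->
  P (map X (x :: s)) - (last x s - x) <=
  P (map (X \o clamp u v) (x :: s)) - (clamp u v (last x s) - clamp u v x).
Proof.
move=> uv; elim: s x => [|y s IH] x.
  by rewrite /= !polygonal_length1 !subrr.
move=> /= /andP[xy ys] sI; rewrite !(polygonal_length_cons2 hC hsym).
have sI' : {subset y :: s <= `[y1, y2]} by move=> z zs; rewrite sI// inE zs orbT.
have := IH y ys sI'; have := sI x (mem_head _ _); have := sI' y (mem_head _ _).
rewrite !in_itv/= => /andP[hy1' hy2'] /andP[hx1 hx2] /= le.
by have := short_clamp uv hx1 xy hy2'; move: le => /=; lra.
Qed.

Lemma shortest_polygon u v s0 : - H <= u -> v <= H -> y2 - y1 <= v - u ->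
  sorted <=%R s0 -> {subset s0 <= `[y1, y2]} ->
  exists s, [/\ sorted <=%R s, {subset s <= `[u, v]} &
    P (map X s0) <= P (map X s)].
Proof.
move=> hu hv huv ss sI; have uv : u <= v by have := hy; lra.
pose c := clamp u v; pose s1 := rcons s0 y2.
have p1 : path <=%R y1 s1.
  rewrite rcons_path; apply/andP; split.
    case: s0 ss sI {s1} => //= z s -> sI.
    by have := sI _ (mem_head _ _); rewrite in_itv/= andbT => /andP[].
  have : last y1 s0 \in y1 :: s0 by exact: mem_last.
  rewrite inE => /orP[/eqP->|/sI]; first exact: ltW.
  by rewrite in_itv/= => /andP[].
have I1 : {subset y1 :: s1 <= `[y1, y2]}.
  move=> z; rewrite inE mem_rcons inE => /orP[/eqP->|/orP[/eqP->|/sI//]];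
  by rewrite in_itv/= lexx ltW.
exists (u :: rcons (map c (y1 :: s1)) v).
have cI z : u <= c z <= v by exact: clamp_itv.
split.
- rewrite /= rcons_path (andP (cI _)).1/=; apply/andP; split.
    by rewrite path_map; apply: sub_path p1 => a b; exact: ler_clamp.
  by rewrite last_map (andP (cI _)).2.
- move=> z; rewrite in_itv inE mem_rcons inE.
  move=> /orP[/eqP->|/orP[/eqP->|/mapP[a _ ->]]] /=; [|by rewrite lexx uv|exact: cI].
  by rewrite lexx uv.
have key := short_clamp_seq uv p1 I1.
rewrite {2}/s1 last_rcons -/c in key.
have e1 : c y1 - u <= N (X (c y1) - X u).
  rewrite /c; case: (clampP y1 uv) => -[a ->]; first by rewrite !subrr (Cnorm0 hC hsym).
    by apply: long_out; lra.
  by apply: long_out; lra.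
have e2 : v - c y2 <= N (X v - X (c y2)).
  rewrite /c; case: (clampP y2 uv) => -[a ->]; last by rewrite !subrr (Cnorm0 hC hsym).
    by apply: long_out; lra.
  by apply: long_out; lra.
have e3 : P (map X s0) <= P (map X (y1 :: s1)).
  apply: le_trans (le_polygonal_length_cons hC hsym (X y1) (map X s1)).
  by rewrite /s1 map_rcons; exact: (le_polygonal_length_rcons hC hsym).
have -> : P (map X (u :: rcons (map c (y1 :: s1)) v)) =
    N (X (c y1) - X u) + (P (map (X \o c) (y1 :: s1)) + N (X v - X (c y2))).
  rewrite /= (polygonal_length_cons2 hC hsym); congr (_ + _).
  rewrite /s1 !map_rcons -rcons_cons -rcons_cons (polygonal_length_rcons hC hsym).
  by rewrite -map_comp.
lra.
Qed.

Lemma shortest_arc_dist (f : R -> 'rV[R]_2) :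
  {within `[0, 1], continuous f} ->
  (forall t, 0 <= t <= 1 -> N (f t) = 1) -> y2 - y1 <= l (f 1 - f 0) ->
  (arc_dist C 0 (X y2 - X y1) <= curve_length C f)%E.
Proof.
have [hy1' hy' hy2'] := And3 hy1 hy hy2.
move=> cf Nf lf; have hz z : y1 <= z <= y2 -> - H <= z <= H.
  by move=> /andP[? ?]; apply/andP; split; lra.
have cX := right_pt_clamp_continuous hC hsym gh HT Hmax.
have XE z : y1 <= z <= y2 -> (X \o clamp (- H) H) z = X z.
  by move=> /hz hz'; rewrite /= clamp_id.
rewrite -(XE y1) -?(XE y2) ?lexx ?(ltW hy)//.
apply: arc_dist_le_param => //.
- by move=> z hz'; rewrite XE// right_pt_Cnorm ?hz.
- move=> z z'; rewrite !in_itv/= => hz1 hz2; rewrite -!/((X \o _) _) !XE//.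
  exact: right_pt_inj.
move=> s0 ss sI.
have -> : map (X \o clamp (- H) H) s0 = map X s0.
  by apply/eq_in_map => z /sI; rewrite in_itv/=; exact: XE.
have lf' : l (f 0) < l (f 1) by move: lf; rewrite levelD levelN; lra.
have [p [q [Cp Cq qp len]]] := curve_lower hC hsym gh HT Hmax cf Nf lf'.
have [|||||s [ss' sI' le]] := @shortest_polygon (l p) (l q) s0.
- by have /andP[] := level_itv hsym Hmax Cp.
- exact: Hmax.
- by move: lf; rewrite -qp levelD levelN.
- exact: ss.
- exact: sI.
apply: le_trans (len s ss' sI'); rewrite lee_fin; apply: le_trans le _.
apply: le_trans (le_polygonal_length_cons hC hsym _ _).
exact: (le_polygonal_length_rcons hC hsym).
Qed.

End shortest.

Section antipodal.

Let D := X H - X (- H).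

Lemma antipodal_lower (f : R -> 'rV[R]_2) s0 :
  {within `[0, 1], continuous f} ->
  (forall t, 0 <= t <= 1 -> N (f t) = 1) -> l (f 1 - f 0) = 2 * H ->
  sorted <=%R s0 -> {subset s0 <= `[- H, H]} ->
  ((N (f 1 - f 0 - D) + P (map X s0))%:E <= curve_length C f)%E.
Proof.
move=> cf Nf lf ss sI.
have lf' : l (f 0) < l (f 1).
  by move: lf; rewrite levelD levelN; have := H0; lra.
have [p [q [Cp Cq qp len]]] := curve_lower hC hsym gh HT Hmax cf Nf lf'.
have /andP[lp1 lp2] := level_itv hsym Hmax Cp.
have /andP[lq1 lq2] := level_itv hsym Hmax Cq.
have lqp : l q - l p = 2 * H by rewrite -lf -qp levelD levelN.
have lp : l p = - H by lra.
have lq : l q = H by lra.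
have ss1 : sorted <=%R (- H :: rcons s0 H).
  rewrite /= rcons_path; apply/andP; split.
    case: s0 ss sI => //= z s -> sI.
    by have := sI _ (mem_head _ _); rewrite in_itv/= andbT => /andP[].
  have : last (- H) s0 \in - H :: s0 by exact: mem_last.
  by rewrite inE => /orP[/eqP->//|/sI]; rewrite in_itv/= => /andP[].
have sI1 : {subset - H :: rcons s0 H <= `[- H, H]}.
  move=> z; rewrite inE mem_rcons inE => /orP[/eqP->|/orP[/eqP->|/sI//]];
  by rewrite in_itv/= lexx ?HH.
apply: le_trans (len _ ss1 _); last by rewrite lp lq.
have n1 : N (f 1 - f 0 - D) <= N (X (- H) - p) + N (q - X H).
  rewrite -qp /D (_ : q - p - _ = (X (- H) - p) + (q - X H)).
    exact: (ler_CnormD hC hsym).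
  by apply/rowP => i; rewrite !mxE; ring.
have n2 : P (map X s0) <= P (X (- H) :: rcons (map X s0) (X H)).
  apply: le_trans (le_polygonal_length_cons hC hsym _ _).
  exact: (le_polygonal_length_rcons hC hsym).
rewrite lee_fin /= map_rcons (polygonal_length_cons2 hC hsym).
by rewrite -!rcons_cons (polygonal_length_rcons hC hsym) rcons_cons; lra.
Qed.

(* The right boundary curve extended to the left along the bottom edge before
   -H and along the top edge after H. *)
Let Y z := X (clamp (- H) H z) - `|z - clamp (- H) H z| *: g.

Let level_Y z : l (Y z) = clamp (- H) H z.
Proof.
have := level_frame 1 0 gh; rewrite scale0r addr0 scale1r => lg.
by rewrite /Y levelD levelN levelZ lg mulr0 subr0 (level_right gh).
Qed.

Let absc_Y z : m (Y z) = Rp (clamp (- H) H z) - `|z - clamp (- H) H z|.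
Proof.
have := absc_frame 1 0 gh; rewrite scale0r addr0 scale1r => mg.
by rewrite /Y abscD abscN abscZ mg mulr1 (absc_right gh).
Qed.

Let clampC := @clamp_continuous R (- H) H HH.

Let Y_continuous : continuous Y.
Proof.
move=> z; apply: (@continuousB _ _ _ (X \o clamp (- H) H)
  (fun z => `|z - clamp (- H) H z| *: g)).
  exact: (right_pt_clamp_continuous hC hsym gh HT Hmax).
apply: cvgZ; last exact: cvg_cst.
apply: cvg_norm; apply: cvgB; [exact: cvg_id|exact: clampC].
Qed.

Let clamp_distP z : let c := clamp (- H) H z in
  [\/ [/\ z <= - H, c = - H & `|z - c| = - H - z],
      [/\ - H <= z <= H, c = z & `|z - c| = 0] |
      [/\ H <= z, c = H & `|z - c| = z - H]].
Proof.
case: (clampP z HH) => -[a ->] /=.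
- by constructor 1; split=> //; rewrite ler0_norm; lra.
- by constructor 2; rewrite subrr normr0.
- by constructor 3; split=> //; rewrite ger0_norm; lra.
Qed.

Let Y_inj : injective Y.
Proof.
move=> z z' e; have := congr1 m e; have := congr1 l e.
rewrite !level_Y !absc_Y => e1; rewrite {1}e1 => /addrI/oppr_inj.
move: e1; have H1 := H0.
case: (clamp_distP z) => -[a1 -> ->]; case: (clamp_distP z') => -[b1 -> ->]; lra.
Qed.

Let Y_length (x : R) s : path <=%R x s ->
  P (map Y (x :: s)) <= P (map (X \o clamp (- H) H) (x :: s)) +
    ((last x s - clamp (- H) H (last x s)) - (x - clamp (- H) H x)) * N g.
Proof.
elim: s x => [|y s IH] x /=; first by rewrite !polygonal_length1 subrr mul0r addr0.
move=> /andP[xy ys]; rewrite !(polygonal_length_cons2 hC hsym).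
have := IH y ys; set a := (y - clamp _ _ y); set b := (x - clamp _ _ x).
set c := _ - clamp _ _ (last _ _); rewrite /= => le.
have ba : `| `|a| - `|b| | <= a - b.
  rewrite /a /b; have H1 := H0.
  case: (clampP x HH) => -[k ->]; case: (clampP y HH) => -[k' ->];
    rewrite ?subrr ?normr0 ?subr0 ?sub0r ?normrN ?normr_id //;
    try (by lra);
    rewrite ?(ler0_norm (x := _ - - H)) ?(ger0_norm (x := _ - H)); try lra;
    rewrite ler_norml; apply/andP; split; lra.
have le1 : N (Y y - Y x) <=
    N (X (clamp (- H) H y) - X (clamp (- H) H x)) + (a - b) * N g.
  have -> : Y y - Y x = (X (clamp (- H) H y) - X (clamp (- H) H x))
      - (`|a| - `|b|) *: g.
    by rewrite /Y -/a -/b; apply/rowP => i; rewrite !mxE; ring.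
  apply: le_trans (ler_CnormB hC hsym _ _) _; rewrite lerD2l.
  have -> : N ((`|a| - `|b|) *: g) = `| `|a| - `|b| | * N g.
    have [k|k] := leP 0 (`|a| - `|b|).
      by rewrite (CnormZ hC hsym)// (ger0_norm k).
    by rewrite -(CnormN hC hsym) -scaleNr (CnormZ hC hsym) ?oppr_ge0 ?(ltW k)// (ltr0_norm k).
  by rewrite ler_wpM2r// Cnorm_ge0.
have -> : (c - b) * N g = (a - b) * N g + (c - a) * N g by ring.
lra.
Qed.

Lemma antipodal_arc_dist w (f : R -> 'rV[R]_2) : C (2^-1 *: w) -> l w = 2 * H ->
  {within `[0, 1], continuous f} ->
  (forall t, 0 <= t <= 1 -> N (f t) = 1) -> l (f 1 - f 0) = 2 * H ->
  N (w - D) <= N (f 1 - f 0 - D) ->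
  (arc_dist C 0 w <= curve_length C f)%E.
Proof.
move=> Cw lw cf Nf lf Nw; have H1 := H0.
pose k := m (w - D); pose mu := Num.max k 0; pose nu := Num.max (- k) 0.
have [mu0 nu0 kE] : [/\ 0 <= mu, 0 <= nu & mu - nu = k].
  by rewrite /mu /nu; have [] := leP k 0; have [] := leP (- k) 0; split; lra.
have wD : w - D = k *: g.
  rewrite [LHS](frameE _ gh) -/k /D levelD levelN levelD levelN !(level_right gh) lw.
  by rewrite (_ : _ - _ = 0) ?scale0r ?addr0//; ring.
have kw : k = m w - Rp H + Rp (- H).
  by rewrite /k /D abscD abscN abscD abscN !(absc_right gh); ring.
have lw2 : l (2^-1 *: w) = H by rewrite levelZ lw; field.
have mw1 := absc_le_right hC hsym gh HT Hmax Cw.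
have mw2 := left_le_absc hC hsym gh HT Hmax Cw.
rewrite lw2 abscZ in mw1 mw2.
have wid : - Rp (- H) <= Rp H by lra.
have muw : mu <= Rp H + Rp (- H).
  by rewrite /mu ge_max; apply/andP; split; lra.
have nuw : nu <= Rp H + Rp (- H).
  by rewrite /nu ge_max; apply/andP; split; lra.
pose z1 := - H - mu; pose z2 := H + nu.
have Y1 : Y z1 = X (- H) - mu *: g.
  rewrite /Y; have -> : clamp (- H) H z1 = - H.
    by rewrite /z1; case: (clampP (- H - mu) HH) => -[c ->]; lra.
  by rewrite /z1 ler0_norm; [congr (_ - _ *: _); ring|lra].
have Y2 : Y z2 = X H - nu *: g.
  rewrite /Y; have -> : clamp (- H) H z2 = H.
    by rewrite /z2; case: (clampP (H + nu) HH) => -[c ->]; lra.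
  by rewrite /z2 ger0_norm; [congr (_ - _ *: _); ring|lra].
have -> : w = Y z2 - Y z1.
  rewrite Y1 Y2 -[LHS](subrK D) wD -kE /D.
  by apply/rowP => i; rewrite !mxE; ring.
have CY z : z1 <= z <= z2 -> C (Y z).
  move=> /andP[a b]; rewrite /z1 /z2 in a b.
  apply: (in_bodyP hC hsym gh HT Hmax); rewrite level_Y ?absc_Y.
  - exact: clamp_itv.
  - case: (clampP z HH) => -[c ->].
    + by rewrite opprK ler0_norm; lra.
    + rewrite subrr normr0 subr0.
      have := left_le_absc hC hsym gh HT Hmax (right_pt_in hC hsym gh HT Hmax c).
      by rewrite (level_right gh) (absc_right gh).
    + by rewrite ger0_norm; lra.
  - by rewrite lerBlDr lerDl.
have NY z : z1 <= z <= z2 -> N (Y z) = 1.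
  move=> hz; have Cz := CY z hz.
  have top : H <= `|l (Y z)| -> N (Y z) = 1.
    move=> le; apply/eqP; rewrite eq_le (Cnorm_le1 Cz)/=.
    have : H * 1 <= H * N (Y z).
      rewrite mulr1; apply: le_trans le _; rewrite ler_norml level_le_Cnorm andbT.
      by rewrite lerNl -levelN -(CnormN hC hsym) level_le_Cnorm.
    by rewrite ler_pM2l.
  have : l (Y z) = clamp (- H) H z by exact: level_Y.
  case: (clampP z HH) => -[c e] lY.
  - by apply: top; rewrite lY e normrN ler_norm.
  - by apply: right_end_Cnorm => //; rewrite lY e absc_Y e subrr normr0 subr0.
  - by apply: top; rewrite lY e ler_norm.
apply: (@arc_dist_le_param Y) => //; first by rewrite /z1 /z2; lra.
- by move=> a b _ _; exact: Y_inj.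
move=> [|x s] ss sI.
  have := antipodal_lower cf Nf lf ss; rewrite /= => /(_ _)/(le_trans _); apply => //.
  by rewrite lee_fin lerDr Cnorm_ge0.
pose c := clamp (- H) H.
have ss' : sorted <=%R (map c (x :: s)).
  by rewrite sorted_map; apply: sub_sorted ss => a b; exact: ler_clamp.
have sI' : {subset map c (x :: s) <= `[- H, H]}.
  by move=> _ /mapP[a _ ->]; rewrite in_itv/=; exact: clamp_itv.
have := antipodal_lower cf Nf lf ss' sI'; apply: le_trans; rewrite lee_fin.
apply: le_trans (Y_length ss) _; rewrite addrC -map_comp lerD2r.
apply: le_trans Nw; rewrite wD.
have -> : N (k *: g) = (mu + nu) * N g.
  rewrite /mu /nu; have [k0|k0] := leP k 0.
    by rewrite -(CnormN hC hsym) -scaleNr (CnormZ hC hsym) ?oppr_ge0// max_l ?oppr_ge0// add0r.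
  by rewrite (CnormZ hC hsym) ?(ltW k0)// max_r ?oppr_le0 ?(ltW k0)// addr0.
rewrite ler_wpM2r ?Cnorm_ge0//.
have := sI x (mem_head _ _); have := sI (last x s) (mem_last _ _).
rewrite !in_itv/= /z1 /z2 => hl hx.
by case: (clampP x HH) => -[c1 ->]; case: (clampP (last x s) HH) => -[c2 ->]; lra.
Qed.

End antipodal.

End comparison.

(** * Existence of shortest arcs *)

Section shortest_arcs.
Context {R : realType} {C : set 'rV[R]_2}.
Hypotheses (hC : plane_convex_body C) (hsym : o_symmetric C).
Implicit Types (a b e g h p r w x : 'rV[R]_2) (s t z : R).
Local Notation N := (Cnorm C).

Lemma support_slope r w b : C b ->
  (forall p, C p -> absc r w p = absc r w b -> level r w p <= level r w b) ->
  (exists2 p, C p & absc r w p < absc r w b) ->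
  (exists2 p, C p & absc r w b < absc r w p) ->
  exists s, forall p, C p ->
    level r w p - level r w b <= s * (absc r w p - absc r w b).
Proof.
set m := absc r w; set l := level r w => Cb top [p0 Cp0 mp0] [p1 Cp1 mp1].
pose slope p := (l p - l b) / (m p - m b).
have le p q : C p -> C q -> m q < m b -> m b < m p -> slope p <= slope q.
  move=> Cp Cq qb bp; pose t := (m b - m q) / (m p - m q).
  have d0 : 0 < m p - m q by lra.
  have t01 : 0 <= t <= 1 by rewrite divr_ge0 ?ler_pdivrMr//=; lra.
  have := top _ (body_conv hC t01 Cp Cq).
  rewrite /m /l abscD levelD !abscZ !levelZ -/m -/l.
  have -> : t * m p + (1 - t) * m q = m b by rewrite /t; field; rewrite gt_eqF.
  move=> /(_ erefl).
  have -> : t * l p + (1 - t) * l q =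
      ((m b - m q) * l p + (m p - m b) * l q) / (m p - m q).
    by rewrite /t; field; rewrite gt_eqF.
  rewrite ler_pdivrMr// => k.
  rewrite /slope ler_pdivrMr ?subr_gt0//.
  have -> : (l q - l b) / (m q - m b) * (m p - m b) =
      (l b - l q) * (m p - m b) / (m b - m q).
    have n1 : m q - m b != 0 by rewrite subr_eq0 lt_eqF.
    have n2 : m b - m q != 0 by rewrite subr_eq0 gt_eqF.
    by field; rewrite ?n1 ?n2.
  by rewrite ler_pdivlMr ?subr_gt0//; nra.
pose S := [set slope p | p in [set p | C p /\ m b < m p]].
have S0 : S !=set0 by exists (slope p1), p1.
have ubS q : C q -> m q < m b -> ubound S (slope q).
  by move=> Cq qb _ [p [Cp bp] <-]; exact: le.
exists (sup S) => p Cp; have [pb|bp|e] := ltgtP (m p) (m b).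
- have : sup S <= slope p by apply: ge_sup => //; exact: ubS.
  by rewrite /slope ler_ndivlMr// subr_lt0.
- have : slope p <= sup S.
    by apply: ub_le_sup; [exists (slope p0); exact: ubS|exists p].
  by rewrite /slope ler_pdivrMr// subr_gt0.
- by rewrite e subrr mulr0 subr_le0; exact: top.
Qed.

Lemma level_self g h : det g h != 0 -> level g h h = 1.
Proof. by move=> /(level_frame 0 1); rewrite scale0r add0r scale1r. Qed.
Lemma absc_self g h : det g h != 0 -> absc g h g = 1.
Proof. by move=> /(absc_frame 1 0); rewrite scale0r addr0 scale1r. Qed.
Lemma absc_snd g h : absc g h h = 0.
Proof. by rewrite /absc /det; ring. Qed.

Lemma absc_shear r e s x : absc (r + s *: e) e x = absc r e x.
Proof. by rewrite /absc /det !mxE; congr (_ / _); ring. Qed.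

Lemma det_shear r e s : det (r + s *: e) e = det r e.
Proof. by rewrite /det !mxE; ring. Qed.

Lemma det_neq0l r e : det r e != 0 -> r != 0.
Proof. by apply: contraNneq => ->; rewrite /det !mxE; apply/eqP; ring. Qed.

Lemma exists_transversal w : w != 0 -> exists r, det r w != 0.
Proof.
move=> w0; exists (\row_j (if j == 0 then w 0 1 else - w 0 0)).
rewrite (_ : det _ w = w 0 0 ^+ 2 + w 0 1 ^+ 2); last first.
  by rewrite /det !mxE /=; ring.
apply: contra_neq w0 => /eqP; rewrite paddr_eq0 ?sqr_ge0//.
by rewrite !sqrf_eq0 => /andP[/eqP e0 /eqP e1]; apply: row2P; rewrite mxE.
Qed.

Lemma body_normalize x : x != 0 -> C ((N x)^-1 *: x).
Proof.
move=> /(Cnorm_gt0 hC hsym) x0; apply: (body_of_Cnorm hC hsym).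
by rewrite (CnormZ hC hsym) ?mulVf ?gt_eqF// invr_ge0 ltW.
Qed.

Lemma Cnorm_normalize x : x != 0 -> N ((N x)^-1 *: x) = 1.
Proof.
move=> /(Cnorm_gt0 hC hsym) x0.
by rewrite (CnormZ hC hsym) ?mulVf ?gt_eqF// invr_ge0 ltW.
Qed.

Lemma support_frame r e : det r e != 0 -> N e = 1 ->
  exists s, forall x, C x -> level (r + s *: e) e x <= 1.
Proof.
move=> re Ne; have r0 := det_neq0l re; have Nr := Cnorm_gt0 hC hsym r0.
have Ce : C e by apply: (body_of_Cnorm hC hsym); rewrite Ne.
have [|||s hs] := @support_slope r e e Ce.
- move=> p Cp; rewrite absc_snd level_self// => mp.
  rewrite leNgt; apply/negP => lp; have := Cnorm_le1 Cp.
  rewrite [p](frameE _ re) mp scale0r add0r (CnormZ hC hsym) ?Ne; first by lra.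
  by apply: ltW; apply: lt_trans lp.
- exists (- ((N r)^-1 *: r)); first exact/(body_opp hsym)/body_normalize.
  by rewrite abscN abscZ absc_self// absc_snd mulr1 oppr_lt0 invr_gt0.
- exists ((N r)^-1 *: r); first exact: body_normalize.
  by rewrite abscZ absc_self// absc_snd mulr1 invr_gt0.
exists s => x /hs; rewrite level_self// absc_snd subr0.
have -> : level (r + s *: e) e x = level r e x - s * absc r e x.
  rewrite /level det_shear /absc /det !mxE; field.
  by move: re; rewrite /det.
lra.
Qed.

(* The hypotheses of shortest_arc_dist for an arc with chord w. *)
Definition short_chord w := exists g h H y1 y2,
  let X := @right_pt R C g h in
  [/\ det g h != 0, exists2 T, C T & level g h T = H &
      forall x, C x -> level g h x <= H] /\
  [/\ - H <= y1, y1 < y2, y2 <= H & X y2 - X y1 = w] /\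
  (forall z z', y1 <= z -> z <= z' -> z' <= y2 -> N (X z' - X z) <= z' - z) /\
  (forall z z', - H <= z -> z <= z' -> z' <= H -> z' <= y1 \/ y2 <= z ->
    z' - z <= N (X z' - X z)).

Lemma short_chord_edge r w a : w != 0 -> det r w != 0 -> C a -> C (a + w) ->
  (forall x, C x -> absc r w x <= absc r w a) -> short_chord w.
Proof.
move=> w0 rw Ca Cb amax; have Nw := Cnorm_gt0 hC hsym w0.
pose e := (N w)^-1 *: w.
have wE : w = N w *: e by rewrite /e scalerA divff ?scale1r ?gt_eqF.
have Ne : N e = 1 by exact: Cnorm_normalize.
have re : det r e = (N w)^-1 * det r w by rewrite /e /det !mxE; ring.
have re0 : det r e != 0 by rewrite re mulf_neq0// invr_eq0 gt_eqF.
have [s hs] := support_frame re0 Ne; set g := r + s *: e in hs.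
have ge : det g e != 0 by rewrite det_shear.
have Ce : C e by apply: (body_of_Cnorm hC hsym); rewrite Ne.
have HT : exists2 T, C T & level g e T = 1 by exists e; rewrite ?level_self.
have mE x : absc g e x = absc r w x.
  rewrite absc_shear /absc re /e /det !mxE; field.
  by move: rw; rewrite /det => ->; rewrite gt_eqF.
pose y1 := level g e a; pose y2 := y1 + N w.
have lb : level g e (a + w) = y2.
  by rewrite levelD; congr (_ + _); rewrite [X in level _ _ X]wE levelZ level_self// mulr1.
have /andP[a1 a2] := level_itv hsym hs Ca; rewrite -/y1 in a1 a2.
have /andP[b1 b2] := level_itv hsym hs Cb; rewrite lb in b1 b2.
have XE z : y1 <= z <= y2 -> @right_pt R C g e z = a + (z - y1) *: e.
  move=> /andP[z1 z2].
  have Cz : C (a + (z - y1) *: e).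
    have t01 : 0 <= (z - y1) / N w <= 1.
      by rewrite divr_ge0 ?ler_pdivrMr ?(ltW Nw)//=; move: z2; rewrite /y2; lra.
    have := body_conv hC t01 Cb Ca.
    congr C; rewrite /e; apply/rowP => i; rewrite !mxE; field.
    by rewrite gt_eqF.
  have lz : level g e (a + (z - y1) *: e) = z.
    by rewrite levelD levelZ level_self// -/y1; ring.
  have hz : -1 <= z <= 1 by lra.
  have := absc_le_right hC hsym ge HT hs Cz; rewrite lz abscD abscZ absc_snd.
  rewrite mulr0 addr0 => k1.
  have := amax _ (right_pt_in hC hsym ge HT hs hz).
  rewrite -!mE (absc_right ge) => k2.
  rewrite /right_pt [RHS](frameE _ ge) lz abscD abscZ absc_snd mulr0 addr0.
  by congr (_ *: _ + _); lra.
exists g, e, 1, y1, y2; split; first by split.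
split; first split => //.
- by rewrite ltrDl.
- rewrite !XE ?lexx ?lerDl ?(ltW Nw)// subrr scale0r addr0 addrC addKr.
  by rewrite [RHS]wE /y2; congr (_ *: _); ring.
split=> [z z' h1 h2 h3|z z' h1 h2 h3 _].
  rewrite !XE; try by apply/andP; split; lra.
  rewrite (_ : _ - _ = (z' - z) *: e).
    by rewrite (CnormZ hC hsym) ?Ne ?mulr1// subr_ge0.
  by apply/rowP => i; rewrite !mxE; ring.
have := level_le_Cnorm hC hsym hs (@right_pt R C g e z' - @right_pt R C g e z).
by rewrite levelD levelN !(level_right ge) mul1r.
Qed.

Lemma level_max g h : exists2 T, C T & forall x, C x -> level g h x <= level g h T.
Proof.
have [cC _ _] := hC.
have [||T] := @EVT_max_rV _ _ (level g h) C _ cC.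
- by exists 0; exact: (body0 hC hsym).
- by apply: continuous_subspaceT; exact: level_continuous.
by rewrite inE => CT max; exists T => // x Cx; apply: max; rewrite inE.
Qed.

Section tangent_frame.
Context {g h : 'rV[R]_2} {H : R}.
Hypotheses (gh : det g h != 0) (HT : exists2 T, C T & level g h T = H).
Hypothesis (Hmax : forall x, C x -> level g h x <= H).
Local Notation l := (level g h).
Local Notation m := (absc g h).
Local Notation Rp := (@right_absc R C g h).
Local Notation X := (@right_pt R C g h).

Let right_concave3 z z' z'' : - H <= z -> z <= z' -> z' <= z'' -> z'' <= H ->
  (z'' - z') * Rp z + (z' - z) * Rp z'' <= (z'' - z) * Rp z'.
Proof.
move=> h1 h2 h3 h4; have [e|ne] := eqVneq z z''.
  have -> : z' = z by lra.
  by rewrite -e !subrr; lra.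
have d0 : 0 < z'' - z by rewrite subr_gt0 lt_neqAle ne; lra.
pose t := (z'' - z') / (z'' - z).
have t01 : 0 <= t <= 1 by rewrite divr_ge0 ?ler_pdivrMr//=; lra.
have hz : - H <= z <= H by lra.
have hz'' : - H <= z'' <= H by lra.
have := right_concave hC hsym gh HT Hmax hz hz'' t01.
have -> : t * z + (1 - t) * z'' = z' by rewrite /t; field; rewrite gt_eqF.
rewrite -(ler_pM2l d0); congr (_ <= _); rewrite /t; field.
by rewrite gt_eqF.
Qed.

Let right_mono_up c z z' z'' : - H <= z -> z <= z' -> z' <= z'' -> z'' <= H ->
  Rp z - c * z <= Rp z'' - c * z'' -> Rp z - c * z <= Rp z' - c * z'.
Proof.
move=> h1 h2 h3 h4 h5; have k := right_concave3 h1 h2 h3 h4.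
have [e|ne] := eqVneq z z''; first by have -> : z' = z by lra.
have d0 : 0 < z'' - z by rewrite subr_gt0 lt_neqAle ne; lra.
rewrite -(ler_pM2l d0); have := ler_wpM2l (_ : 0 <= z' - z) h5; nra.
Qed.

Let right_mono_down c z z' z'' : - H <= z -> z <= z' -> z' <= z'' -> z'' <= H ->
  Rp z'' - c * z'' <= Rp z - c * z -> Rp z'' - c * z'' <= Rp z' - c * z'.
Proof.
move=> h1 h2 h3 h4 h5; have k := right_concave3 h1 h2 h3 h4.
have [e|ne] := eqVneq z z''; first by have -> : z' = z'' by lra.
have d0 : 0 < z'' - z by rewrite subr_gt0 lt_neqAle ne; lra.
rewrite -(ler_pM2l d0); nra.
Qed.

(* g + h and h are the tangent directions f and e at the ends of the chord. *)
Hypotheses (Nh : N h = 1) (Ngh : N (g + h) = 1).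

Let Cnorm_le_level x : 0 <= m x -> 0 <= l x - m x -> N x <= l x.
Proof.
move=> m0 lm0; rewrite {1}(frameE x gh).
rewrite (_ : _ + _ = m x *: (g + h) + (l x - m x) *: h); last first.
  by apply/rowP => i; rewrite !mxE; ring.
apply: le_trans (ler_CnormD hC hsym _ _) _.
by rewrite !(CnormZ hC hsym)// Nh Ngh; lra.
Qed.

Let level_le_Cnorm_out x : 0 <= l x -> m x <= 0 \/ l x <= m x -> l x <= N x.
Proof.
move=> l0 [m0|lm0].
  have : N ((l x - m x) *: h) <= N x + N ((- m x) *: (g + h)).
    apply: le_trans (ler_CnormD hC hsym _ _).
    rewrite le_eqVlt; apply/orP; left; apply/eqP; congr N.
    by rewrite {3}(frameE x gh); apply/rowP => i; rewrite !mxE; ring.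
  by rewrite !(CnormZ hC hsym) ?Nh ?Ngh; lra.
have : N (m x *: (g + h)) <= N x + N ((m x - l x) *: h).
  apply: le_trans (ler_CnormD hC hsym _ _).
  rewrite le_eqVlt; apply/orP; left; apply/eqP; congr N.
  by rewrite {2}(frameE x gh); apply/rowP => i; rewrite !mxE; ring.
by rewrite !(CnormZ hC hsym) ?Nh ?Ngh; lra.
Qed.

Lemma short_chord_tangent a b : C a -> C b -> a != b ->
  (forall x, C x -> m x <= m b) ->
  (forall x, C x -> l a - m a <= l x - m x) -> short_chord (b - a).
Proof.
move=> Ca Cb ab bmax amin.
have /andP[a1 a2] := level_itv hsym Hmax Ca.
have /andP[b1 b2] := level_itv hsym Hmax Cb.
have CX z : - H <= z -> z <= H -> C (X z).
  by move=> h1 h2; apply: (right_pt_in hC hsym gh HT Hmax); rewrite h1.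
have Rmax z : - H <= z -> z <= H -> Rp z <= m b.
  by move=> h1 h2; have := bmax _ (CX z h1 h2); rewrite (absc_right gh).
have Rmin z : - H <= z -> z <= H -> Rp z - z <= m a - l a.
  move=> h1 h2; have := amin _ (CX z h1 h2).
  by rewrite (absc_right gh) (level_right gh); lra.
have Rb : Rp (l b) = m b.
  have := absc_le_right hC hsym gh HT Hmax Cb; have := Rmax _ b1 b2; lra.
have Ra : Rp (l a) = m a.
  have := absc_le_right hC hsym gh HT Hmax Ca; have := Rmin _ a1 a2; lra.
have Xb : X (l b) = b by rewrite /right_pt Rb -frameE.
have Xa : X (l a) = a by rewrite /right_pt Ra -frameE.
have lab : l a < l b.
  have := bmax _ Ca; have := amin _ Cb => k1 k2.
  rewrite lt_neqAle; apply/andP; split; last by lra.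
  apply: contra_neq ab => e.
  by rewrite -Xa -Xb e.
exists g, h, H, (l a), (l b); split; first by split.
split; first by split; rewrite ?Xa ?Xb.
have lX z z' : l (X z' - X z) = z' - z.
  by rewrite levelD levelN !(level_right gh).
have mX z z' : m (X z' - X z) = Rp z' - Rp z.
  by rewrite abscD abscN !(absc_right gh).
split=> [z z' h1 h2 h3|z z' h1 h2 h3 h4].
  have := @Cnorm_le_level (X z' - X z); rewrite lX mX; apply.
    have := @right_mono_up 0 z z' (l b); rewrite Rb !mul0r !subr0 => k.
    have : Rp z <= Rp z' by apply: k => //; [lra|apply: Rmax; lra].
    lra.
  have := @right_mono_down 1 (l a) z z'; rewrite Ra !mul1r => k.
  have : Rp z' - z' <= Rp z - z by apply: k => //; [lra|apply: Rmin; lra].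
  lra.
have := @level_le_Cnorm_out (X z' - X z); rewrite lX mX; apply; first by lra.
case: h4 => h4.
  right; have := @right_mono_up 1 z z' (l a); rewrite Ra !mul1r => k.
  have : Rp z - z <= Rp z' - z' by apply: k => //; apply: Rmin; lra.
  lra.
left; have := @right_mono_down 0 (l b) z z'; rewrite Rb !mul0r !subr0 => k.
have : Rp z' <= Rp z by apply: k => //; apply: Rmax; lra.
lra.
Qed.

End tangent_frame.

Lemma exists_short_chord w : w != 0 -> N w < 2 -> short_chord w.
Proof.
move=> w0 Nw2; have Nw := Cnorm_gt0 hC hsym w0.
have [r rw] := exists_transversal w0.
have r0 := det_neq0l rw; have Nr := Cnorm_gt0 hC hsym r0.
set m := absc r w; set l := level r w.
have mw : m w = 0 by exact: absc_snd.
have lw : l w = 1 by exact: level_self.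
have cT : continuous (fun x : 'rV[R]_2 => x + w).
  by move=> x; apply: continuousD; [|exact: cst_continuous].
pose d := (1 - N w / 2) / N r; have d0 : 0 < d by rewrite divr_gt0//; lra.
pose x0 := - (2^-1 *: w) + d *: r.
have [Cx0 Cx0w] : C x0 /\ C (x0 + w).
  have -> : x0 + w = 2^-1 *: w + d *: r.
    by apply/rowP => i; rewrite !mxE; field.
  split; apply: (body_of_Cnorm hC hsym);
    apply: le_trans (ler_CnormD hC hsym _ _) _;
    rewrite ?(CnormN hC hsym) !(CnormZ hC hsym) ?(ltW d0)//;
    rewrite divfK ?gt_eqF//; lra.
have [|||a] := @compact_EVT_max _ _ m (C `&` [set x | C (x + w)]).
- by exists x0.
- have [cC _ _] := hC; apply: compact_closedI => //.
  rewrite (_ : [set x | _] = (fun x => x + w) @^-1` C)//.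
  apply: closed_comp; first by move=> ? _; exact: cT.
  by apply: compact_closed => //; exact: norm_hausdorff.
- by apply: continuous_subspaceT; exact: absc_continuous.
rewrite inE => -[Ca /= Cb] amax.
have {}amax x : C x -> C (x + w) -> m x <= m a.
  by move=> Cx Cxw; apply: amax; rewrite inE.
have [[p1 [Cp1 mp1]]|nop] := pselect (exists p, C p /\ m a < m p); last first.
  apply: (short_chord_edge w0 rw Ca Cb) => x Cx.
  by rewrite leNgt; apply/negP => lt; apply: nop; exists x.
have ma0 : 0 < m a.
  have := amax _ Cx0 Cx0w.
  by rewrite /m abscD abscN !abscZ absc_self// -/m mw mulr0 mulr1; lra.
(* A chord in direction w longer than w in the same section could be moved
   towards p1. *)
have push k x : C x -> C (x + (1 + k) *: w) -> m x = m a -> k <= 0.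
  move=> Cx Cxk mx; rewrite leNgt; apply/negP => k0.
  have k10 : 0 < 1 + k by lra.
  pose t := (1 + k)^-1; have t1 : 0 <= t <= 1.
    by rewrite /t invr_ge0 (ltW k10)/= invf_le1//; lra.
  have : m (t *: x + (1 - t) *: p1) <= m a.
    apply: amax; first exact: body_conv.
    have := body_conv hC t1 Cxk Cp1; congr C.
    by apply/rowP => i; rewrite !mxE /t; field; rewrite gt_eqF.
  rewrite /m abscD !abscZ -/m mx.
  have : t < 1 by rewrite /t invf_lt1//; lra.
  by nra.
have wsub x (k : R) : level r w (x + k *: w) = l x + k.
  by rewrite levelD levelZ -/l lw mulr1.
have mb : m (a + w) = m a by rewrite /m abscD -/m mw addr0.
have lb : l (a + w) = l a + 1 by rewrite /l levelD -/l lw.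
have Cv := body_normalize w0; set v := (N w)^-1 *: w in Cv.
have mv : m v = 0 by rewrite /m abscZ -/m mw mulr0.
have lv : l v = (N w)^-1 by rewrite /l levelZ -/l lw mulr1.
have [|||s1 hs1] := @support_slope r w _ Cb.
- move=> p Cp; rewrite -/m -/l mb lb => mp; rewrite -lerBlDl -subr_le0.
  apply: (push _ a) => //; rewrite (_ : _ + _ = p)//.
  rewrite [RHS](frameE p rw) -/m -/l mp {1}(frameE a rw) -/m -/l.
  by apply/rowP => i; rewrite !mxE; ring.
- by exists v => //; rewrite -/m mv mb.
- by exists p1 => //; rewrite -/m mb.
have detNr x : det x (- w) = - det x w by rewrite /det !mxE; ring.
have rNw : det r (- w) != 0 by rewrite detNr oppr_eq0.
have mN x : absc r (- w) x = m x.
  by rewrite /absc !detNr invrN mulrNN.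
have lN x : level r (- w) x = - l x.
  by rewrite /level detNr invrN mulrN.
have [|||s2 hs2] := @support_slope r (- w) _ Ca.
- move=> p Cp; rewrite !mN !lN lerN2 => mp; rewrite -subr_le0.
  apply: (push _ p) => //.
  rewrite (_ : _ + _ = a + w)//.
  rewrite {1}(frameE p rw) -/m -/l mp [X in _ = X + _](frameE a rw) -/m -/l.
  by apply/rowP => i; rewrite !mxE; ring.
- by exists v => //; rewrite !mN mv.
- by exists p1 => //; rewrite !mN.
have {}hs1 x : C x -> l x - l a - 1 <= s1 * (m x - m a).
  by move=> /hs1; rewrite -/m -/l mb lb; lra.
have {}hs2 x : C x -> (- s2) * (m x - m a) <= l x - l a.
  by move=> /hs2; rewrite !mN !lN; lra.
pose s3 := - s2; have slope : s1 < s3.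
  have k1 := hs1 _ Cv; have k2 := hs2 _ (body_opp hsym Cv).
  rewrite /m /l abscN levelN -/m -/l in k2.
  rewrite mv lv in k1; rewrite mv lv in k2.
  have k3 : 1 < 2 * (N w)^-1 by rewrite ltr_pdivlMr// mul1r.
  rewrite -/s3 in k2; rewrite -(ltr_pM2r ma0); lra.
have rs0 s : r + s *: w != 0.
  apply: contra_neq rw => e; rewrite -(det_shear r w s) e /det !mxE; ring.
have Ns s := Cnorm_gt0 hC hsym (rs0 s).
pose kf := (N (r + s3 *: w))^-1; pose ke := (N (r + s1 *: w))^-1.
pose f := kf *: (r + s3 *: w); pose e := - (ke *: (r + s1 *: w)).
have kf0 : 0 < kf by rewrite invr_gt0.
have ke0 : 0 < ke by rewrite invr_gt0.
have Nf : N f = 1 by exact: Cnorm_normalize.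
have Ne : N e = 1 by rewrite (CnormN hC hsym); exact: Cnorm_normalize.
pose g := f - e.
have nE : kf * ke * (s3 - s1) * det r w != 0.
  by rewrite !mulf_eq0 (gt_eqF kf0) (gt_eqF ke0) subr_eq0 (gt_eqF slope).
have ge : det g e = kf * ke * (s3 - s1) * det r w.
  by rewrite /g /f /e /det !mxE; ring.
have ge0 : det g e != 0 by rewrite ge.
have mE x : absc g e x = (l x - s1 * m x) / (kf * (s3 - s1)).
  rewrite {1}/absc ge {1}(frameE x rw) -/m -/l /g /f /e.
  have -> : det (m x *: r + l x *: w) (- (ke *: (r + s1 *: w))) =
      ke * (l x - s1 * m x) * det r w by rewrite /det !mxE; ring.
  by field; rewrite rw subr_eq0 (gt_eqF slope) (gt_eqF kf0) (gt_eqF ke0).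
have lmE x : level g e x - absc g e x = (l x - s3 * m x) / (ke * (s3 - s1)).
  rewrite /absc /level -mulrBl ge {1 2}(frameE x rw) -/m -/l.
  have -> : det g (m x *: r + l x *: w) - det (m x *: r + l x *: w) e =
      kf * (l x - s3 * m x) * det r w by rewrite /g /f /e /det !mxE; ring.
  by field; rewrite rw subr_eq0 (gt_eqF slope) (gt_eqF kf0) (gt_eqF ke0).
have [T CT Tmax] := level_max g e.
have -> : w = (a + w) - a by rewrite addrC addKr.
apply: (@short_chord_tangent g e (level g e T) ge0) => //.
- by exists T.
- by rewrite /g subrK.
- by rewrite -subr_eq0 opprD addrA subrr add0r oppr_eq0.
- move=> x /hs1 k; rewrite !mE ler_pM2r ?invr_gt0 ?mulr_gt0 ?subr_gt0//.
  by rewrite mb lb; lra.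
- move=> x /hs2 k; rewrite !lmE ler_pM2r ?invr_gt0 ?mulr_gt0 ?subr_gt0//.
  by rewrite -/s3 in k; lra.
Qed.

End shortest_arcs.

Section quasiconvexity.
Context {R : realType} {C : set 'rV[R]_2}.
Hypotheses (hC : plane_convex_body C) (hsym : o_symmetric C).
Implicit Types (w : 'rV[R]_2) (f : R -> 'rV[R]_2) (t : R).
Local Notation N := (Cnorm C).

Lemma curve_length_ge0 f : (0 <= curve_length C f)%E.
Proof.
apply: ereal_sup_ubound; exists [::]; first by split.
by rewrite /polygonal_length big_nil.
Qed.

Lemma arc_dist00 : (arc_dist C 0 0 <= 0)%E.
Proof.
pose e : 'rV[R]_2 := const_mx 1.
have e0 : e != 0.
  apply/eqP => /(congr1 (fun x : 'rV[R]_2 => x 0 0)).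
  by rewrite !mxE; apply/eqP; exact: oner_neq0.
apply: (@le_trans _ _ (curve_length C (fun=> 0))).
  apply: ereal_inf_lbound; exists (fun=> 0) => //; split.
    split=> //; last by right.
    by apply: continuous_subspaceT => x; exact: cvg_cst.
  exists ((N e)^-1 *: e) => _ [t _ <-]; apply/(bd_translateP hC hsym).
  by rewrite sub0r (CnormN hC hsym) (Cnorm_normalize hC hsym).
apply/ereal_supP => _ [s _ <-]; rewrite lee_fin.
elim: s => [|x [|y s] IH]; [by rewrite /polygonal_length big_nil|by rewrite polygonal_length1|].
by rewrite /= (polygonal_length_cons2 hC hsym) subrr (Cnorm0 hC hsym) add0r.
Qed.

Definition boundary_chord w f := [/\ {within `[0, 1], continuous f},
  forall t, 0 <= t <= 1 -> N (f t) = 1 & f 1 - f 0 = w].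

Lemma arc_dist_conv w1 w2 f1 f2 t : 0 < t < 1 ->
  boundary_chord w1 f1 -> boundary_chord w2 f2 ->
  (arc_dist C 0 (t *: w1 + (1 - t) *: w2) <=
    maxe (curve_length C f1) (curve_length C f2))%E.
Proof.
move=> /andP[t0 t1] [cf1 Nf1 <-] [cf2 Nf2 <-].
set w1' := f1 1 - f1 0; set w2' := f2 1 - f2 0.
have Nw f : (forall t, 0 <= t <= 1 -> N (f t) = 1) -> N (f 1 - f 0) <= 2.
  move=> Nf; have := ler_CnormB hC hsym (f 1) (f 0).
  by rewrite !Nf ?lexx ?ler01//; lra.
have Nw1 := Nw _ Nf1; have Nw2 := Nw _ Nf2.
set w := t *: w1' + (1 - t) *: w2'.
have Nwc x y : N (t *: x + (1 - t) *: y) <= t * N x + (1 - t) * N y.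
  apply: le_trans (ler_CnormD hC hsym _ _) _.
  by rewrite !(CnormZ hC hsym) ?(ltW t0)// subr_ge0 ltW.
have [->|w0] := eqVneq w 0.
  by rewrite le_max (le_trans arc_dist00 (curve_length_ge0 f1)).
have [Nw2'|Nw2'] := ltP (N w) 2.
  have [g [h [H [y1 [y2 [[gh HT Hmax] [[h1 h2 h3 wE] [short long]]]]]]]] :=
    exists_short_chord hC hsym w0 Nw2'.
  have lw : y2 - y1 = level g h w.
    by rewrite -wE levelD levelN !(level_right gh).
  rewrite -[X in arc_dist _ _ X]wE le_max.
  have : (y2 - y1 <= level g h w1') || (y2 - y1 <= level g h w2').
    rewrite lw /w levelD !levelZ; apply/negPn/negP; rewrite negb_or -!ltNge.
    by move=> /andP[k1 k2]; nra.
  case/orP => k.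
    by rewrite (shortest_arc_dist hC hsym gh HT Hmax h1 h2 h3 short long cf1).
  by rewrite (shortest_arc_dist hC hsym gh HT Hmax h1 h2 h3 short long cf2) ?orbT.
have [r rw] := exists_transversal w0.
have NwE : N w = 2.
  by apply/eqP; rewrite eq_le Nw2' andbT; apply: le_trans (Nwc _ _) _; nra.
pose e := 2^-1 *: w.
have Ne : N e = 1 by rewrite (CnormZ hC hsym) ?NwE// mulVf.
have re : det r e != 0.
  rewrite (_ : det r e = 2^-1 * det r w) ?mulf_neq0// /e /det !mxE; ring.
have [s hs] := support_frame hC hsym re Ne.
set g := r + s *: e in hs.
have ge : det g e != 0 by rewrite det_shear.
have Ce : C e by apply: (body_of_Cnorm hC hsym); rewrite Ne.
have le : level g e e = 1 by exact: level_self.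
have HT : exists2 T, C T & level g e T = 1 by exists e.
have lw : level g e w = 2 * 1.
  have wE : w = 2 *: e by rewrite /e scalerA divff ?scale1r.
  by rewrite [X in level _ _ X]wE levelZ le.
have lN x : N x <= 2 -> level g e x <= 2.
  by move=> Nx; have := level_le_Cnorm hC hsym hs x; lra.
have [lw1 lw2] : level g e w1' = 2 * 1 /\ level g e w2' = 2 * 1.
  have := lN _ Nw1; have := lN _ Nw2.
  have := levelD g e (t *: w1') ((1 - t) *: w2'); rewrite !levelZ lw => kw k2 k1.
  by split; nra.
set D := @right_pt R C g e 1 - @right_pt R C g e (-1).
have kD : (N (w - D) <= N (w1' - D)) || (N (w - D) <= N (w2' - D)).
  have := Nwc (w1' - D) (w2' - D).
  rewrite (_ : _ + _ = w - D); last first.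
    by rewrite /w; apply/rowP => i; rewrite !mxE; ring.
  move=> k; apply/negPn/negP; rewrite negb_or -!ltNge => /andP[k1 k2].
  by nra.
rewrite le_max; case/orP: kD => k.
  by rewrite (antipodal_arc_dist hC hsym ge HT hs Ce lw cf1 Nf1 lw1 k).
by rewrite (antipodal_arc_dist hC hsym ge HT hs Ce lw cf2 Nf2 lw2 k) orbT.
Qed.

Lemma arc_boundary_chord w g y : arc 0 w g ->
  g @` `[0, 1] `<=` bd (translate y C) -> boundary_chord w (fun t => g t - y).
Proof.
move=> [cg g0 g1 _] gbd; split; last by rewrite /= g0 g1 sub0r opprK subrK.
  by move=> x; apply: cvgB; [exact: cg|exact: cvg_cst].
move=> t ht; apply/(bd_translateP hC hsym); apply: gbd.
by exists t => //=; rewrite in_itv.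
Qed.

End quasiconvexity.

Theorem theorem5 (R : realType) (C : set 'rV[R]_2) (rho : R)
  (hC : plane_convex_body C) (hsym : o_symmetric C)
  (rho_ge0 : 0 <= rho) (rho_le : (rho%:E <= (2^-1)%:E * perim C C)%E) :
  convex_set (arc_disk C rho).
Proof.
apply/convex_setW => w1 w2; rewrite !inE => -[d1 a1] [d2 a2] k k0 k1.
rewrite inE; have -> : conv k w1 w2 = k%:num *: w1 + (1 - k%:num) *: w2 by [].
move: (k%:num) k0 k1 => t t0 t1 {k}.
have NE w : Cdist C 0 w = Cnorm C w by rewrite /Cdist sub0r (CnormN hC hsym).
rewrite !NE in d1 d2; split.
  rewrite NE; apply: le_trans (ler_CnormD hC hsym _ _) _.
  by rewrite !(CnormZ hC hsym) ?(ltW t0)//; [nra|lra].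
rewrite leNgt; apply/negP => lt.
have chord w : (arc_dist C 0 w <= rho%:E)%E -> exists f,
    boundary_chord (C := C) w f /\
    (curve_length C f < arc_dist C 0 (t *: w1 + (1 - t) *: w2))%E.
  move=> aw; have [_ [g [ag [y gy]] <-] lg] := ereal_inf_lt (le_lt_trans aw lt).
  exists (fun t => g t - y); split; first exact: (arc_boundary_chord hC hsym).
  by rewrite (curve_length_shift hC hsym).
have [f1 [c1 l1]] := chord _ a1; have [f2 [c2 l2]] := chord _ a2.
have t01 : 0 < t < 1 by rewrite t0.
have := arc_dist_conv hC hsym t01 c1 c2.
by rewrite leNgt gt_max l1 l2.
Qed.
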